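(* Let $\mathbf b=(b_1,b_2)\in\mathbb N^2$ with $\gcd(b_1,b_2)=1$, let $r\ge1$ be an integer and $\boldsymbol\alpha=(\alpha_1,\dots,\alpha_r)$ with $0<\alpha_j<1$. For $1\le j\le r$ let $(P^{(j)}_i)_{i\ge0}$ be an $\alpha_j$-random walk, the $r$ walks being mutually independent. Let $Y_i=1$ if all of $P^{(1)}_i,\dots,P^{(r)}_i$ are $\mathbf b$-visible from the origin and $Y_i=0$ otherwise, and let $\overline R(n)=\frac1n\sum_{i=1}^nY_i$. Then almost surely $$\lim_{n\to\infty}\overline R(n)=\prod_p\Big(1-\frac1{p^{b_\star}}+\frac1{p^{b_\star}}\Big(1-\frac1{p^{b^\star}}\Big)^r\Big),$$ where $b_\star=\min(b_1,b_2)$, $b^\star=\max(b_1,b_2)$ and $p$ runs over all primes.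
   Context: $\mathbf b$-visibility: given two distinct lattice points $P=(p_1,p_2)$, $Q=(q_1,q_2)\in\mathbb Z^2$, they determine a curve through both of the form $a_1(y-q_2)^{b_1}=a_2(x-q_1)^{b_2}$ for some $(a_1,a_2)\in\mathbb Q^2\setminus\{(0,0)\}$; $P$ is called $\mathbf b$-visible from $Q$ if no other lattice point lies on the segment of this curve between $P$ and $Q$. A point $P\ne(0,0)$ is $\mathbf b$-visible if it is $\mathbf b$-visible from the origin. An $\alpha$-random walk ($0<\alpha<1$) starting at the origin is defined by $P_0=(0,0)$ and $P_{i+1}=P_i+(1,0)$ with probability $\alpha$, $P_{i+1}=P_i+(0,1)$ with probability $1-\alpha$, the steps being independent. *)

(* Defs.v *)
From HB Require Import structures.
From mathcomp Require Import all_boot all_order all_algebra.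
From mathcomp Require Import all_classical all_reals all_analysis.
Set Implicit Arguments. Unset Strict Implicit. Unset Printing Implicit Defensive.
Import Order.TTheory GRing.Theory Num.Theory.
Local Open Scope classical_set_scope.
Local Open Scope ring_scope.

Definition lpoint := (int * int)%type.

Definition on_bcurve (b1 b2 : nat) (Q : lpoint) (a : rat * rat) (R : lpoint) : Prop :=
  a.1 * ((R.2 - Q.2) ^+ b1)%:~R = a.2 * ((R.1 - Q.1) ^+ b2)%:~R.

(* R lies in the closed box spanned by P and Q.  On the (monotone) branch of
   the curve a1 (y-q2)^b1 = a2 (x-q1)^b2 joining Q to P, the points of the
   curve lying in this box are exactly the points of the segment of the
   curve between P and Q. *)
Definition in_box (P Q R : lpoint) : Prop :=
  (Num.min P.1 Q.1 <= R.1 <= Num.max P.1 Q.1) /\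
  (Num.min P.2 Q.2 <= R.2 <= Num.max P.2 Q.2).

Definition bvisible_from (b1 b2 : nat) (P Q : lpoint) : Prop :=
  P <> Q /\
  forall a : rat * rat, a <> (0, 0) -> on_bcurve b1 b2 Q a P ->
    forall R : lpoint, on_bcurve b1 b2 Q a R -> in_box P Q R -> R = P \/ R = Q.

Definition bvisible (b1 b2 : nat) (P : lpoint) : Prop :=
  bvisible_from b1 b2 P (0, 0).

(* The walk driven by the step sequence s : s k = true means the (k+1)-th
   step is (1,0), s k = false means it is (0,1).  walk s 0 = (0,0) and
   walk s (i+1) = walk s i + (1,0) or (0,1) according to s i. *)
Definition walk (s : nat -> bool) (i : nat) : lpoint :=
  (((\sum_(k < i) nat_of_bool (s k))%N)%:Z,
   ((\sum_(k < i) nat_of_bool (~~ s k))%N)%:Z).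

Definition mutually_independent (R : realType) (d : measure_display)
  (T : measurableType d) (P : probability T R) (I : eqType) (X : I -> T -> bool) : Prop :=
  forall (s : seq I) (v : I -> bool), uniq s ->
    P [set w | all (fun k => X k w == v k) s] =
    (\prod_(k <- s) P [set w | X k w = v k])%E.

Definition Rbar (R : realType) (T : Type) (b1 b2 r : nat)
  (step : 'I_r -> nat -> T -> bool) (n : nat) (w : T) : R :=
  n%:R^-1 * \sum_(1 <= i < n.+1)
     (`[< forall j : 'I_r, bvisible b1 b2 (walk (fun k => step j k w) i) >] : nat)%:R.

Definition efactor (R : realType) (b1 b2 r : nat) (p : nat) : R :=
  let bs := minn b1 b2 in let bS := maxn b1 b2 in
  1 - (p%:R ^+ bs)^-1 + (p%:R ^+ bs)^-1 * (1 - (p%:R ^+ bS)^-1) ^+ r.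

Definition euler_partial (R : realType) (b1 b2 r : nat) (N : nat) : R :=
  \prod_(p < N | prime p) efactor R b1 b2 r p.

(* Main.v *)
Require Import Defs.
From HB Require Import structures.
From mathcomp Require Import all_boot all_order all_algebra.
From mathcomp Require Import all_classical all_reals all_analysis.
From mathcomp Require Import measurable_realfun zify ring lra.
Import Order.TTheory GRing.Theory Num.Theory numFieldNormedType.Exports.
Local Open Scope classical_set_scope.
Local Open Scope ring_scope.

(**
For positive x and y, the point (x, y) is b-visible iff no prime p satisfies
p^b1 | x and p^b2 | y; with i = x + y and z the coordinate carrying the larger
exponent, this says that no p has p^min | i and p^max | z.

Let Y_i indicate that all walks are visible at time i and let G_i be the
conditional expectation of Y_i given the first i - h steps. The differences
Y_i - G_i are orthogonal at distance >= h, so the second moment of their average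
over i <= n is O(h / n); with n = k^6 and h = k^4 this is summable in k, hence
these averages tend to 0 almost surely, and the passage from k^6 to all n is
elementary.

The G_i are controlled deterministically. Stein's identity for the binomial law
bounds E f(Z + 1) - E f(Z) by O(h^(-1/2)) for bounded f, so Z is nearly
equidistributed modulo any fixed number, and P(p | Z) <= 1/p + O(h^(-1/2))
uniformly in p. Sieving by the primes p < N gives the partial Euler product by the
Chinese remainder theorem; the primes p >= N cost at most sum_(p | i, p >= N) r/p
on average over i, that is O(1/N), plus an error controlled by the number of prime
divisors of i.
*)

(** * Visibility and prime powers *)

Lemma dvdn_log_le (m n : nat) : (0 < m)%N -> (0 < n)%N ->
  (forall p, prime p -> (logn p m <= logn p n)%N) -> (m %| n)%N.
Proof.
move=> m0 n0 H; apply/(dvdn_partP _ m0) => p; rewrite mem_primes => /andP[pp _].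
by rewrite p_part pfactor_dvdn // H.
Qed.

(* With [l] the p-adic valuation, [b1 * (l y - l v) = b2 * (l x - l u)] and
   coprimality give [l x - l u = b1 * t], [l y - l v = b2 * t]; the hypothesis on
   primes excludes [t > 0]. *)
Lemma curve_point_ge (b1 b2 x y u v : nat) : (0 < b1)%N -> (0 < b2)%N ->
  coprime b1 b2 -> (0 < x)%N -> (0 < y)%N -> (0 < u)%N -> (0 < v)%N ->
  (forall p, prime p -> ~~ ((p ^ b1 %| x) && (p ^ b2 %| y)))%N ->
  (v ^ b1 * x ^ b2 = u ^ b2 * y ^ b1)%N -> (x <= u)%N.
Proof.
move=> b10 b20 cb x0 y0 u0 v0 np E.
apply: dvdn_leq => //; apply: dvdn_log_le => // p pp.
have := congr1 (logn p) E; rewrite !lognM ?expn_gt0 ?x0 ?y0 ?u0 ?v0 // !lognX.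
have := np p pp; rewrite !pfactor_dvdn //.
set lx := logn p x; set ly := logn p y; set lu := logn p u; set lv := logn p v.
move=> nb El; rewrite leqNgt; apply/negP => lt.
have lvy : (lv < ly)%N by nia.
have E2 : (b1 * (ly - lv) = b2 * (lx - lu))%N by rewrite !mulnBr; lia.
have d1 : (b1 %| lx - lu)%N by rewrite -(Gauss_dvdr _ cb) -E2 dvdn_mulr.
have d2 : (b2 %| ly - lv)%N.
  by rewrite -(Gauss_dvdr _ (n:=b1)) 1?coprime_sym // E2 dvdn_mulr.
have l1 := dvdn_leq _ d1; have l2 := dvdn_leq _ d2.
by move/negP: nb; apply; apply/andP; split; lia.
Qed.

(** If [p] violates the condition, [(x / p ^ b1, y / p ^ b2)] is a lattice point of the same curve
    strictly inside the box. Conversely, a box point of the curve other than the origin has positive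
    coordinates, and [curve_point_ge], applied to each coordinate in turn, forces it to be the
    endpoint. *)
Lemma bvisibleP (b1 b2 x y : nat) : (0 < b1)%N -> (0 < b2)%N ->
  coprime b1 b2 -> (0 < x)%N -> (0 < y)%N ->
  bvisible b1 b2 (x%:Z, y%:Z) <->
  (forall p, prime p -> ~~ ((p ^ b1 %| x) && (p ^ b2 %| y)))%N.
Proof.
move=> b10 b20 cb x0 y0; split.
  move=> [_ H] p pp; apply/negP => /andP[/dvdnP[u xE] /dvdnP[v yE]].
  have pb1 : (1 < p ^ b1)%N by rewrite -(exp1n b1) ltn_exp2r ?prime_gt1.
  have pb2 : (1 < p ^ b2)%N by rewrite -(exp1n b2) ltn_exp2r ?prime_gt1.
  have u0 : (0 < u)%N by move: x0; rewrite xE; case: (u).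
  have v0 : (0 < v)%N by move: y0; rewrite yE; case: (v).
  (* The coefficients [(x ^ b2, y ^ b1)] are those of the curve through [(x, y)]. *)
  have /(_ _ _ (u%:Z, v%:Z)) := H ((x ^ b2)%N%:R, (y ^ b1)%N%:R).
  rewrite /on_bcurve /in_box /= !subr0.
  have nz : ((x ^ b2)%N%:R, (y ^ b1)%N%:R) <> ((0, 0) : rat * rat).
    by move=> [/eqP]; rewrite pnatr_eq0 expn_eq0; lia.
  have natE (z b : nat) : ((z%:Z ^+ b)%:~R : rat) = (z ^ b)%N%:R.
    by rewrite -[z%:Z]natz -natrX natz -pmulrn.
  rewrite !natE -!natrM => /(_ nz) H1.
  have {}H1 : (u%:Z, v%:Z) = (x%:Z, y%:Z) \/ (u%:Z, v%:Z) = (0, 0).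
    apply: H1.
    - by rewrite mulnC.
    - apply/eqP; rewrite eqr_nat; apply/eqP.
      rewrite {1}xE [in RHS]yE !expnMn -!expnM (mulnC b1 b2).
      by rewrite mulnAC [RHS]mulnAC (mulnC (u ^ _)%N).
    - by split; nia.
  case: H1 => -[]; last by lia.
  by move=> ux _; nia.
move=> np; split; first by case=> xe ye; move: x0; rewrite xe.
move=> [a1 a2] anz; rewrite /on_bcurve /in_box /= !subr0 => EP [u' v'] /=.
rewrite !subr0 => ER [/andP[u1 u2] /andP[v1 v2]].
have [u uE] : exists u : nat, u' = u%:Z by exists `|u'|%N; lia.
have [v vE] : exists v : nat, v' = v%:Z by exists `|v'|%N; lia.
subst u' v'.
have natE (z b : nat) : ((z%:Z ^+ b)%:~R : rat) = (z ^ b)%N%:R.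
  by rewrite -[z%:Z]natz -natrX natz -pmulrn.
move: EP ER; rewrite !natE => EP ER.
have nx b : (0 < b)%N -> (x ^ b)%N%:R != 0 :> rat.
  by move=> _; rewrite pnatr_eq0 expn_eq0; lia.
have ny b : (0 < b)%N -> (y ^ b)%N%:R != 0 :> rat.
  by move=> _; rewrite pnatr_eq0 expn_eq0; lia.
have a10 : a1 != 0.
  apply/eqP => a0; apply: anz; move: EP; rewrite a0 mul0r => /esym/eqP.
  by rewrite mulf_eq0 (negPf (nx _ _)) // orbF => /eqP ->.
have a20 : a2 != 0.
  apply/eqP => a0; apply: anz; move: EP; rewrite a0 mul0r => /eqP.
  by rewrite mulf_eq0 (negPf (ny _ _)) // orbF => /eqP ->.
(* Cross-multiplying the two curve equations and cancelling [a1 * a2] eliminates the rational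
   coefficients. *)
have E : (v ^ b1 * x ^ b2 = u ^ b2 * y ^ b1)%N.
  apply/eqP; rewrite -(eqr_nat rat) !natrM.
  have /mulfI inj : a1 * a2 != 0 by rewrite mulf_neq0.
  apply/eqP/inj.
  transitivity ((a1 * (v ^ b1)%N%:R) * (a2 * (x ^ b2)%N%:R)); first by ring.
  by rewrite ER -EP; ring.
have [u0|u0] := posnP u.
  right; move: E; rewrite u0 (exp0n b20) mul0n => /eqP.
  rewrite muln_eq0 !expn_eq0; have := x0; case: (v) => [|v''] /= => ?; last by lia.
  by [].
have v0 : (0 < v)%N.
  rewrite lt0n; apply/eqP => v0; move: E; rewrite v0 (exp0n b10) mul0n => /esym/eqP.
  by rewrite muln_eq0 !expn_eq0; lia.
have xu := curve_point_ge _ _ _ _ _ _ b10 b20 cb x0 y0 u0 v0 np E.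
have yv : (y <= v)%N.
  apply: (curve_point_ge b2 b1 y x v u) => //; first by rewrite coprime_sym.
  by move=> p pp; rewrite andbC np.
by left; congr (_, _); lia.
Qed.

(** Where the larger power of [p] divides its coordinate, so does the smaller one, and the other
    coordinate may be replaced by [x + y]. Along a walk this sum is the deterministic time, so only
    one coordinate stays random. *)
Lemma dvdn_pair_min_max (b1 b2 p x y : nat) :
  ((p ^ b1 %| x) && (p ^ b2 %| y) =
   (p ^ minn b1 b2 %| x + y) && (p ^ maxn b1 b2 %| if b2 <= b1 then x else y))%N.
Proof.
case: (leqP b2 b1) => h.
- have hp : (p ^ b2 %| p ^ b1)%N by rewrite dvdn_exp2l.
  rewrite andbC; case: (boolP (p ^ b1 %| x)%N) => dx; rewrite ?andbF // !andbT.
  by rewrite dvdn_addr // (dvdn_trans hp).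
- have hp : (p ^ b1 %| p ^ b2)%N by rewrite dvdn_exp2l ?(ltnW h).
  case: (boolP (p ^ b2 %| y)%N) => dy; rewrite ?andbF // !andbT.
  by rewrite dvdn_addl // (dvdn_trans hp).
Qed.

(** * Means of periodic functions *)

Definition mean (R : realType) (m : nat) (f : nat -> R) : R :=
  m%:R^-1 * \sum_(i < m) f i.

Definition periodic (R : realType) (m : nat) (f : nat -> R) : Prop :=
  forall i, f (i + m)%N = f i.

Lemma periodic_modn (R : realType) (m : nat) (f : nat -> R) : periodic R m f ->
  forall i, f (i %% m)%N = f i.
Proof.
move=> pf i; rewrite [in RHS](divn_eq i m) addnC.
elim: (i %/ m)%N => [|k IH]; first by rewrite mul0n addn0.
by rewrite mulSnr addnA pf.
Qed.

Lemma periodic_sum_shift (R : realType) (m : nat) (f : nat -> R) (z : nat) :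
  periodic R m f -> \sum_(t < m) f (z + t)%N = \sum_(t < m) f t.
Proof.
move=> pf; elim: z => [|z IH]; first by [].
rewrite -IH; case: m pf {IH} => [|m] pf; first by rewrite !big_ord0.
rewrite big_ord_recr big_ord_recl /= addn0 addrC addSnnS pf; congr (_ + _).
by apply: eq_bigr => i _; rewrite addSnnS.
Qed.

Lemma mean_shift (R : realType) (m : nat) (f : nat -> R) (z : nat) : (0 < m)%N ->
  periodic R m f -> \sum_(t < m) f (z + t)%N = m%:R * mean R m f.
Proof.
move=> m0 pf; rewrite periodic_sum_shift // /mean mulrA divff ?mul1r //.
by rewrite pnatr_eq0 -lt0n.
Qed.

(** By the Chinese remainder theorem, [x] runs through every pair of residues exactly once, so the
    sum factors. *)
Lemma mean_coprime (R : realType) (m n : nat) (f g : nat -> R) :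
  (0 < m)%N -> (0 < n)%N -> coprime m n -> periodic R m f -> periodic R n g ->
  mean R (m * n) (fun x => f x * g x) = mean R m f * mean R n g.
Proof.
move=> m0 n0 cmn pf pg; rewrite /mean natrM invfM.
rewrite mulrACA; congr (_ * _); rewrite big_distrlr /= pair_big /=.
pose h (x : 'I_(m * n)) : 'I_m * 'I_n :=
  (Ordinal (ltn_pmod x m0), Ordinal (ltn_pmod x n0)).
have hinj : injective h.
  move=> x y [ex ey]; apply/val_inj => /=.
  have : (x == y %[mod m * n])%N by rewrite chinese_remainder // ex ey !eqxx.
  by rewrite !modn_small // => /eqP.
have hbij : bijective h by apply: inj_card_bij => //; rewrite card_prod !card_ord.
rewrite [RHS](reindex h) /=; last exact: onW_bij.
by apply: eq_bigr => x _; rewrite !periodic_modn.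
Qed.

(** A common period of the conditions [p ^ e %| x] for all primes [p < N]. *)
Definition primorial (e N : nat) : nat := \prod_(p < N | prime p) (p ^ e)%N.

Lemma primorial_gt0 (e N : nat) : (0 < primorial e N)%N.
Proof. by apply: prodn_cond_gt0 => p pp; rewrite expn_gt0 prime_gt0. Qed.

Lemma periodicM (R : realType) (m k : nat) (f : nat -> R) :
  periodic R m f -> periodic R (k * m) f.
Proof.
move=> pf i; elim: k => [|k IH]; first by rewrite mul0n addn0.
by rewrite mulSnr addnA pf.
Qed.

(** Induction on [N]: a new prime power is coprime to the period reached so far, so [mean_coprime]
    splits off its factor. *)
Lemma mean_prod_primes (R : realType) (e N : nat) (F : nat -> nat -> R) :
  (forall p, prime p -> periodic R (p ^ e) (F p)) ->
  periodic R (primorial e N) (fun x => \prod_(p < N | prime p) F p x) /\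
  mean R (primorial e N) (fun x => \prod_(p < N | prime p) F p x) =
  \prod_(p < N | prime p) mean R (p ^ e) (F p).
Proof.
move=> pF; split.
  move=> i; apply: eq_bigr => p pp.
  rewrite /primorial (bigD1 p) //= mulnC; exact: (periodicM _ _ _ _ (pF p pp)).
elim: N => [|N IH].
  by rewrite /mean /primorial !big_ord0 big_ord1 big_ord0 invr1 mulr1.
have recR (G : nat -> R) : \prod_(p < N.+1 | prime p) G p =
    (\prod_(p < N | prime p) G p) * (if prime N then G N else 1).
  by rewrite big_mkcond big_ord_recr /= -big_mkcond.
have -> : primorial e N.+1 = (primorial e N * if prime N then N ^ e else 1)%N.
  by rewrite /primorial big_mkcond big_ord_recr /= -big_mkcond.
rewrite (recR (fun p => mean R (p ^ e) (F p))) -IH.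
have [pN|npN] := boolP (prime N); last first.
  rewrite muln1 mulr1; congr (_ * _); apply: eq_bigr => i _.
  by rewrite (recR (fun p => F p i)) (negPf npN) mulr1.
rewrite -mean_coprime //.
- by congr (_ * _); apply: eq_bigr => i _; rewrite (recR (fun p => F p i)) pN.
- exact: primorial_gt0.
- by rewrite expn_gt0 prime_gt0.
- apply: (big_ind (fun x => coprime x (N ^ e))) => [|x y cx cy|p pp].
  + exact: coprime1n.
  + by rewrite coprimeMl cx.
  + rewrite coprimeXl // coprimeXr // prime_coprime // dvdn_prime2 //.
    by have := ltn_ord p; lia.
- move=> i; apply: eq_bigr => p pp.
  rewrite /primorial (bigD1 p) //= mulnC; exact: (periodicM _ _ _ _ (pF p pp)).
- exact: pF.
Qed.

Lemma periodic_dvd (R : realType) (q : nat) (a c : R) :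
  periodic R q (fun x => if (q %| x)%N then a else c).
Proof. by move=> i; rewrite dvdn_addl. Qed.

Lemma mean_dvd (R : realType) (q : nat) (a : R) : (0 < q)%N ->
  mean R q (fun x => if (q %| x)%N then a else 1) = 1 - q%:R^-1 + q%:R^-1 * a.
Proof.
case: q => // q _; rewrite /mean big_ord_recl dvdn0.
have nd (i : 'I_q) : (q.+1 %| lift ord0 i)%N = false.
  by rewrite gtnNdvd // ltn_ord.
under eq_bigr => i _ do rewrite nd.
rewrite sumr_const card_ord.
have q0 : q.+1%:R != 0 :> R by rewrite pnatr_eq0.
apply: (mulfI q0); rewrite mulrA mulfV // mul1r mulrDr mulrBr mulr1 mulrA mulfV //.
by rewrite mul1r -[in RHS]natr1 addrK addrC.
Qed.

(** Full periods contribute exactly [m] times the mean and are removed by strong induction. For the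
    remaining [n < m] terms, both quantities compared lie between [0] and [n]. *)
Lemma sum_periodic_mean (R : realType) (m n z : nat) (f : nat -> R) : (0 < m)%N ->
  periodic R m f -> (forall i, 0 <= f i <= 1) ->
  `|\sum_(i < n) f (z + i)%N - n%:R * mean R m f| <= m%:R.
Proof.
move=> m0 pf f01.
have natsum k : k%:R = \sum_(i < k) 1 :> R by rewrite sumr_const card_ord.
have mn01 : 0 <= mean R m f <= 1.
  rewrite /mean mulr_ge0 ?invr_ge0 ?sumr_ge0 //=; last by move=> i _; case/andP: (f01 i).
  rewrite ler_pdivrMl ?ltr0n // mulr1 natsum.
  by apply: ler_sum => i _; case/andP: (f01 i).
elim/ltn_ind: n z => n IH z.
have [nm|mn] := ltnP n m.
  have S01 : 0 <= \sum_(i < n) f (z + i)%N <= n%:R.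
    rewrite sumr_ge0 /=; last by move=> i _; case/andP: (f01 (z + i)%N).
    rewrite natsum.
    by apply: ler_sum => i _; case/andP: (f01 (z + i)%N).
  have nm' : n%:R <= m%:R :> R by rewrite ler_nat ltnW.
  have n0 : 0 <= n%:R :> R by [].
  by rewrite ler_norml; nra.
rewrite -(subnKC mn) big_split_ord /= natrD mulrDl mean_shift //.
rewrite opprD addrACA subrr add0r.
under eq_bigr => i _ do rewrite addnA.
by apply: IH; lia.
Qed.

(** * Equidistribution of the binomial law *)

(* [iter h (bstep R a) f x] is the expectation of [f (x + Z)] for [Z ~ Bin(h, a)]. *)
Definition bstep (R : realType) (a : R) (f : nat -> R) : nat -> R :=
  fun x => (1 - a) * f x + a * f x.+1.

Section BernoulliSteps.
Context (R : realType) (a : R).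
Hypothesis a01 : 0 < a < 1.

Notation K h := (iter h (bstep R a)).

Lemma eq_bsteps h f g : f =1 g -> K h f =1 K h g.
Proof. by move=> fg; elim: h => [|h IH] x //=; rewrite /bstep !IH. Qed.

Lemma bstepsD h f g x : K h (fun z => f z + g z) x = K h f x + K h g x.
Proof. by elim: h x => [|h IH] x //=; rewrite /bstep !IH; ring. Qed.

Lemma bstepsZ h c f x : K h (fun z => c * f z) x = c * K h f x.
Proof. by elim: h x => [|h IH] x //=; rewrite /bstep !IH; ring. Qed.

Lemma bstepsB h f g x : K h (fun z => f z - g z) x = K h f x - K h g x.
Proof. by elim: h x => [|h IH] x //=; rewrite /bstep !IH; ring. Qed.

Lemma bsteps_const h c x : K h (fun=> c) x = c.
Proof. by elim: h x => [|h IH] x //=; rewrite /bstep !IH; ring. Qed.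

Lemma bsteps_sum h n (F : nat -> nat -> R) x :
  K h (fun z => \sum_(t < n) F t z) x = \sum_(t < n) K h (F t) x.
Proof.
elim: n => [|n IH].
  by rewrite big_ord0 -[RHS](bsteps_const h 0 x); apply: eq_bsteps => z; rewrite big_ord0.
rewrite big_ord_recr /= -IH -bstepsD.
by apply: eq_bsteps => z; rewrite big_ord_recr.
Qed.

Lemma bsteps_shift h f t x : K h f (x + t)%N = K h (fun z => f (z + t)%N) x.
Proof. by elim: h x => [|h IH] x //=; rewrite /bstep -!IH addSn. Qed.

Lemma bsteps_le h f g x : (forall z, f z <= g z) -> K h f x <= K h g x.
Proof.
have [a0 a1] := andP a01.
move=> fg; elim: h x => [|h IH] x //=; rewrite /bstep.
by apply: lerD; apply: ler_wpM2l; rewrite ?IH //; lra.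
Qed.

Lemma bsteps01 h f x : (forall z, 0 <= f z <= 1) -> 0 <= K h f x <= 1.
Proof.
move=> f01; apply/andP; split.
  by rewrite -(bsteps_const h 0 x); apply: bsteps_le => z; case/andP: (f01 z).
by rewrite -[leRHS](bsteps_const h 1 x); apply: bsteps_le => z; case/andP: (f01 z).
Qed.

(* Stein's identity for the binomial distribution: with [Z ~ Bin(h+1, a)],
   [E((Z - (h+1)a) f(x + Z)) = (h+1) a (1-a) E(f(x + Z' + 1) - f(x + Z'))] where
   [Z' ~ Bin(h, a)]. *)
Lemma binomial_stein h f x :
  K h.+1 (fun z => (z%:R - x%:R - h.+1%:R * a) * f z) x =
  h.+1%:R * a * (1 - a) * K h (fun z => f z.+1 - f z) x.
Proof.
elim: h x => [|h IH] x.
  by rewrite /= /bstep -natr1; ring.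
have e1 : K h.+1 (fun z => (z%:R - x%:R - h.+2%:R * a) * f z) x =
    K h.+1 (fun z => (z%:R - x%:R - h.+1%:R * a) * f z) x - a * K h.+1 f x.
  rewrite -bstepsZ -bstepsB; apply: eq_bsteps => z; rewrite -[h.+2%:R]natr1; ring.
have e2 : K h.+1 (fun z => (z%:R - x%:R - h.+2%:R * a) * f z) x.+1 =
    K h.+1 (fun z => (z%:R - x.+1%:R - h.+1%:R * a) * f z) x.+1
    + (1 - a) * K h.+1 f x.+1.
  rewrite -bstepsZ -bstepsD; apply: eq_bsteps => z.
  by rewrite -[h.+2%:R]natr1 -[x.+1%:R]natr1; ring.
rewrite iterS {1}/bstep e1 e2 !IH.
have e3 : K h.+1 (fun z => f z.+1 - f z) x = K h.+1 f x.+1 - K h.+1 f x.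
  rewrite bstepsB -(addn1 x) bsteps_shift; congr (_ - _).
  by apply: eq_bsteps => z; rewrite addn1.
have e4 : K h.+1 (fun z => f z.+1 - f z) x =
   (1 - a) * K h (fun z => f z.+1 - f z) x + a * K h (fun z => f z.+1 - f z) x.+1.
  by [].
rewrite -[h.+2%:R]natr1.
transitivity (h.+1%:R * a * (1 - a) * ((1 - a) * K h (fun z => f z.+1 - f z) x
   + a * K h (fun z => f z.+1 - f z) x.+1) + a * (1 - a) * (K h.+1 f x.+1 - K h.+1 f x)).
  by ring.
by rewrite -e4 -e3; ring.
Qed.

Lemma binomial_variance h x :
  K h.+1 (fun z => (z%:R - x%:R - h.+1%:R * a) ^+ 2) x = h.+1%:R * a * (1 - a).
Proof.
rewrite -[RHS]mulr1 -[X in _ = _ * X](bsteps_const h 1 x).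
have := binomial_stein h (fun z => z%:R - x%:R - h.+1%:R * a) x.
rewrite (eq_bsteps h (fun z => z.+1%:R - _ - _ - _) (fun=> 1)).
  by move=> <-; apply: eq_bsteps => z; rewrite expr2.
by move=> z; rewrite -natr1; ring.
Qed.

(** Stein's identity expresses the expected difference through the centred variable [e] times [f].
    The bound [|e * f| <= (e ^ 2 / t + t) / 2] and the binomial variance then give the estimate,
    using [t ^ 2 <= h] and [a * (1 - a) <= 1]. *)
Lemma bsteps_diff_bound (h t : nat) f x : (0 < t)%N -> (t ^ 2 <= h)%N ->
  (forall z, `|f z| <= 1) ->
  `|K h (fun z => f z.+1 - f z) x| <= (a * (1 - a))^-1 / t%:R.
Proof.
have [a0 a1] := andP a01.
move=> t0 th f1; set D := K h _ x.
have t0' : 0 < t%:R :> R by rewrite ltr0n.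
have St := binomial_stein h f x; rewrite -/D in St.
have V := binomial_variance h x.
pose e z : R := z%:R - x%:R - h.+1%:R * a.
have amgm z : `|e z * f z| <= 2^-1 * (t%:R^-1 * e z ^+ 2 + t%:R).
  rewrite normrM.
  have le1 : `|e z| * `|f z| <= `|e z| by rewrite -[leRHS]mulr1 ler_wpM2l.
  apply: (le_trans le1).
  have -> : e z ^+ 2 = `|e z| ^+ 2 by rewrite real_normK // num_real.
  set u := `|e z|; rewrite -(ler_pM2l t0').
  have -> : t%:R * (2^-1 * (t%:R^-1 * u ^+ 2 + t%:R)) = 2^-1 * (u ^+ 2 + t%:R ^+ 2).
    by field; rewrite gt_eqF.
  by have := sqr_ge0 (u - t%:R); rewrite sqrrB; lra.
have ub : `|h.+1%:R * a * (1 - a) * D| <=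
    2^-1 * (t%:R^-1 * (h.+1%:R * a * (1 - a)) + t%:R).
  rewrite -St -V -[X in _ + X](bsteps_const h.+1 t%:R x) -bstepsZ -bstepsD -bstepsZ.
  rewrite ler_norml -[- K _ _ _]mulN1r -bstepsZ; apply/andP; split.
    apply: bsteps_le => z; have := amgm z; rewrite ler_norml => /andP[+ _].
    by rewrite mulN1r.
  by apply: bsteps_le => z; have := amgm z; rewrite ler_norml => /andP[_ +].
have [c0 c1] : 0 < a * (1 - a) /\ a * (1 - a) <= 1 by split; nra.
have h0 : 0 < h.+1%:R :> R by rewrite ltr0n.
have th' : t%:R ^+ 2 <= h.+1%:R :> R by rewrite -natrX ler_nat ltnW.
move: ub; rewrite -!mulrA (mulrA a); move: (a * (1 - a)) c0 c1 => c c0 c1.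
rewrite !normrM (gtr0_norm h0) (gtr0_norm c0) => ub.
have := normr_ge0 D; set d := `|D| in ub * => d0.
rewrite -invfM -[leRHS]mul1r ler_pdivlMr ?mulr_gt0 //.
rewrite -(ler_pM2l h0) mulr1.
have : t%:R * (h.+1%:R * (c * d)) <= 2^-1 * (h.+1%:R * c + t%:R ^+ 2).
  rewrite -(ler_pM2l t0') in ub; apply: (le_trans ub).
  by rewrite le_eqVlt; apply/orP; left; apply/eqP; field; rewrite gt_eqF.
have -> : h.+1%:R * (d * (c * t%:R)) = t%:R * (h.+1%:R * (c * d)) by ring.
by move=> ub2; nra.
Qed.

(** Moving the starting point by [u] changes the expectation by at most [u * D], while averaging
    over the [m] starting points of a period gives the mean exactly. *)
Lemma bsteps_periodic (h t m : nat) f x : (0 < t)%N -> (t ^ 2 <= h)%N ->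
  (0 < m)%N -> periodic R m f -> (forall z, 0 <= f z <= 1) ->
  `|K h f x - mean R m f| <= m%:R * ((a * (1 - a))^-1 / t%:R).
Proof.
have [a0 a1] := andP a01.
move=> t0 th m0 pf f01; set D := _ / _.
have D0 : 0 <= D by rewrite /D divr_ge0 // invr_ge0 mulr_ge0; lra.
have m0' : 0 < m%:R :> R by rewrite ltr0n.
have f1 z : `|f z| <= 1 by case/andP: (f01 z) => z0 z1; rewrite ger0_norm.
have step z : `|K h f z.+1 - K h f z| <= D.
  have := bsteps_diff_bound h t f z t0 th f1; rewrite bstepsB.
  by rewrite (eq_bsteps h (fun z => f z.+1) (fun z => f (z + 1)%N)) -?bsteps_shift
    ?addn1 // => y; rewrite addn1.
have steps u : `|K h f x - K h f (x + u)%N| <= u%:R * D.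
  elim: u => [|u IH]; first by rewrite addn0 subrr normr0 mul0r.
  have -> : K h f x - K h f (x + u.+1)%N =
     (K h f x - K h f (x + u)%N) - (K h f (x + u).+1 - K h f (x + u)%N).
    by rewrite addnS; ring.
  by apply: (le_trans (ler_normB _ _)); rewrite -natr1 mulrDl mul1r lerD.
have avg : \sum_(u < m) K h f (x + u)%N = m%:R * mean R m f.
  rewrite -[RHS](bsteps_const h _ x).
  under eq_bigr => u _ do rewrite bsteps_shift.
  rewrite -(bsteps_sum h m (fun u z => f (z + u)%N)); apply: eq_bsteps => z.
  exact: mean_shift.
rewrite -(ler_pM2l m0') -{1}(gtr0_norm m0') -normrM mulrBr -avg.
have -> : m%:R * K h f x = \sum_(u < m) K h f x.
  by rewrite sumr_const card_ord mulr_natl.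
rewrite -sumrB; apply: (le_trans (ler_norm_sum _ _ _)).
have -> : m%:R * (m%:R * D) = \sum_(u < m) (m%:R * D).
  by rewrite sumr_const card_ord mulr_natl.
apply: ler_sum => u _.
apply: (le_trans (steps u)); apply: ler_wpM2r => //.
by rewrite ler_nat ltnW.
Qed.

(* The window sums [\sum_(u < t') 1(q | z + u)] are bounded by 1 and have
   discrete derivative [1(q | z + t') - 1(q | z)], so all residue classes have
   the same probability up to [D], uniformly in [q]. *)
Lemma bsteps_dvd (h t q x : nat) : (0 < t)%N -> (t ^ 2 <= h)%N -> (0 < q)%N ->
  K h (fun z => (q %| z)%N%:R) x <= q%:R^-1 + (a * (1 - a))^-1 / t%:R.
Proof.
move=> t0 th q0; set D := _ / _; set f := fun z : nat => (q %| z)%N%:R : R.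
have q0' : 0 < q%:R :> R by rewrite ltr0n.
have pf : periodic R q f by move=> i; rewrite /f dvdn_addl.
have f0 z : 0 <= f z by rewrite /f; case: (_ %| _)%N.
have full z : \sum_(u < q) f (z + u)%N = 1.
  rewrite periodic_sum_shift // (bigD1 (Ordinal q0)) //= big1 ?addr0 /f ?dvdn0 //.
  move=> i /eqP ni; rewrite gtnNdvd // lt0n; apply/eqP => i0; apply: ni.
  exact/val_inj.
have cmp u : (u < q)%N -> K h f x <= K h f (x + u)%N + D.
  move=> uq; pose g z := \sum_(v < u) f (z + v)%N.
  have g1 z : `|g z| <= 1.
    rewrite ger0_norm ?sumr_ge0 // -(full z) -(subnKC (ltnW uq)) big_split_ord /=.
    by rewrite lerDl sumr_ge0.
  have gd z : g z.+1 - g z = f (z + u)%N - f z.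
    have e1 : \sum_(v < u.+1) f (z + v)%N = g z + f (z + u)%N by rewrite big_ord_recr.
    have e2 : \sum_(v < u.+1) f (z + v)%N = f z + g z.+1.
      rewrite big_ord_recl addn0; congr (_ + _); apply: eq_bigr => v _.
      by rewrite /= /bump /= add1n addSnnS.
    by move: e1; rewrite e2; lra.
  have := bsteps_diff_bound h t g x t0 th g1; rewrite (eq_bsteps h _ _ gd).
  rewrite bstepsB -bsteps_shift ler_norml => /andP[+ _].
  by rewrite -/D; lra.
rewrite -(ler_pM2l q0') mulrDr mulfV ?gt_eqF //.
have avg : \sum_(u < q) K h f (x + u)%N = 1.
  rewrite -[RHS](bsteps_const h _ x).
  under eq_bigr => u _ do rewrite bsteps_shift.
  by rewrite -(bsteps_sum h q (fun u z => f (z + u)%N)); apply: eq_bsteps.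
have natsum c : q%:R * c = \sum_(u < q) c by rewrite sumr_const card_ord mulr_natl.
rewrite !natsum -[X in X + _]avg.
by rewrite -big_split; apply: ler_sum => u _; apply: cmp.
Qed.

End BernoulliSteps.

(** * Conditional expectations of words *)

Section ConditionalExpectation.
Context (R : realType) (C : finType) (wt : C -> R).
Hypothesis wt_ge0 : forall c, 0 <= wt c.
Hypothesis wt_sum1 : \sum_c wt c = 1.

(* For a sequence of independent letters of law [wt], the conditional
   expectation of [F] of the prefix of size [size s + n], given that the prefix
   of size [size s] is [s]. *)
Fixpoint cexp (n : nat) (F : seq C -> R) (s : seq C) : R :=
  if n is m.+1 then \sum_c wt c * cexp m F (rcons s c) else F s.

Lemma le_cexp n F G s :
  (forall s', size s' = (size s + n)%N -> F s' <= G s') -> cexp n F s <= cexp n G s.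
Proof.
elim: n s => [|n IH] s FG /=; first by apply: FG; rewrite addn0.
apply: ler_sum => c _; apply: ler_wpM2l => //; apply: IH => s' es.
by apply: FG; rewrite es size_rcons addSnnS.
Qed.

Lemma eq_cexp n F G s :
  (forall s', size s' = (size s + n)%N -> F s' = G s') -> cexp n F s = cexp n G s.
Proof.
move=> FG; apply/eqP; rewrite eq_le; apply/andP.
by split; apply: le_cexp => s' es; rewrite FG.
Qed.

Lemma cexp_const n k s : cexp n (fun=> k) s = k.
Proof.
elim: n s => [|n IH] s //=.
by under eq_bigr => c _ do rewrite IH; rewrite -mulr_suml wt_sum1 mul1r.
Qed.

Lemma cexpB n F G s : cexp n (fun s => F s - G s) s = cexp n F s - cexp n G s.
Proof.
elim: n s => [|n IH] s //=.
by under eq_bigr => c _ do rewrite IH mulrBr; rewrite sumrB.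
Qed.

Lemma cexp_sum n (I : Type) (r : seq I) (P : pred I) (F : I -> seq C -> R) s :
  cexp n (fun s => \sum_(i <- r | P i) F i s) s = \sum_(i <- r | P i) cexp n (F i) s.
Proof.
elim: n s => [|n IH] s //=.
under eq_bigr => c _ do rewrite IH mulr_sumr.
by rewrite exchange_big /=.
Qed.

Lemma cexp_tower m n F s : cexp (m + n) F s = cexp m (cexp n F) s.
Proof.
by elim: m s => [|m IH] s //=; apply: eq_bigr => c _; rewrite IH.
Qed.

(** Taking out what is known: the first factor depends only on [m] letters that [s] already
    fixes. *)
Lemma cexp_known n m (psi F : seq C -> R) s : (m <= size s)%N ->
  cexp n (fun s' => psi (take m s') * F s') s = psi (take m s) * cexp n F s.
Proof.
elim: n s => [|n IH] s ms //=.
rewrite mulr_sumr; apply: eq_bigr => c _; rewrite IH ?size_rcons ?(leqW ms) //.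
by rewrite -cats1 takel_cat // mulrCA.
Qed.

Lemma cexp_take n m (psi : seq C -> R) s : (m <= size s)%N ->
  cexp n (fun s' => psi (take m s')) s = psi (take m s).
Proof.
move=> ms; rewrite -[RHS]mulr1 -[X in _ = _ * X](cexp_const n 1 s) -cexp_known //.
by apply: eq_cexp => s' _; rewrite mulr1.
Qed.

Context (h : nat) (Y : seq C -> R).
Hypothesis Y01 : forall s, 0 <= Y s <= 1.

(** The difference [Y_i - G_i] of the overview, when [h <= i]. For [i < h] the truncated subtraction
    spoils this reading, so the sums below start at [h]. *)
Definition recentred (i : nat) (s : seq C) : R :=
  Y (take i s) - cexp h Y (take (i - h) s).

Lemma cexp01 n s : 0 <= cexp n Y s <= 1.
Proof.
apply/andP; split.
  by rewrite -(cexp_const n 0 s); apply: le_cexp => s' _; case/andP: (Y01 s').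
by rewrite -[leRHS](cexp_const n 1 s); apply: le_cexp => s' _; case/andP: (Y01 s').
Qed.

Lemma norm_recentred i s : `|recentred i s| <= 1.
Proof.
have /andP[y0 y1] := Y01 (take i s); have /andP[z0 z1] := cexp01 h (take (i - h) s).
by rewrite ler_norml /recentred; lra.
Qed.

(** Given the first [l - h] letters, [recentred i] is determined, because [i <= l - h], and
    [recentred l] has conditional expectation zero. *)
Lemma recentred_orthogonal n i l : (i + h <= l)%N -> (l <= n)%N ->
  cexp n (fun s => recentred i s * recentred l s) [::] = 0.
Proof.
move=> il ln; have -> : n = ((l - h) + (h + (n - l)))%N by lia.
rewrite cexp_tower -[RHS](cexp_const (l - h) 0 [::]); apply: eq_cexp => s /=.
rewrite add0n => es.
have -> : (fun s => recentred i s * recentred l s) =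
    (fun s => (fun u => recentred i u) (take (l - h) s) * recentred l s).
  apply/funext => s'; congr (_ * _); rewrite /recentred !take_takel //; lia.
rewrite cexp_known ?es // /recentred cexpB.
rewrite (cexp_take _ (l - h) (cexp h Y)) ?es // (@take_oversize _ (l - h) s) ?es //.
have E : cexp h (cexp (n - l) (fun s => Y (take l s))) s = cexp h Y s.
  apply: eq_cexp => s' es'; rewrite (cexp_take _ l Y) ?take_oversize //; lia.
by rewrite cexp_tower E subrr mulr0.
Qed.

(** By orthogonality only the pairs at distance less than [h] survive. Each contributes at most [1],
    and each row contains at most [2 * h] of them. *)
Lemma recentred_second_moment n :
  cexp n (fun s => (\sum_(h <= i < n.+1) recentred i s) ^+ 2) [::] <=
  (n.+1 * (2 * h))%N%:R.
Proof.
rewrite (_ : (fun s => _) = (fun s => \sum_(h <= i < n.+1) \sum_(h <= l < n.+1)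
  recentred i s * recentred l s)); last first.
  by apply/funext => s; rewrite expr2 big_distrlr.
rewrite cexp_sum.
have row i : (h <= i < n.+1)%N ->
    cexp n (fun s => \sum_(h <= l < n.+1) recentred i s * recentred l s) [::]
    <= (2 * h)%N%:R.
  move=> /andP[hi iN]; rewrite cexp_sum.
  apply: (@le_trans _ _ (\sum_(h <= l < n.+1 | (i < l + h) && (l < i + h)) 1)%N%:R).
    rewrite natr_sum [leRHS]big_mkcond; apply: ler_sum_nat => l /andP[hl lN].
    case: ifPn => [_|]; last first.
      rewrite negb_and -!leqNgt => /orP[le|le].
        rewrite (_ : (fun s => _) = (fun s => recentred l s * recentred i s)).
          by rewrite recentred_orthogonal.
        by apply/funext => s; rewrite mulrC.
      by rewrite recentred_orthogonal.
    rewrite -[leRHS](cexp_const n 1 [::]); apply: le_cexp => s _.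
    have := norm_recentred i s; have := norm_recentred l s.
    rewrite !ler_norml => /andP[? ?] /andP[? ?]; nra.
  rewrite ler_nat sum1_count -size_filter.
  rewrite -[leqRHS](size_iota (i - h)); apply: uniq_leq_size.
    by rewrite filter_uniq // iota_uniq.
  by move=> l; rewrite mem_filter mem_index_iota mem_iota; lia.
apply: (@le_trans _ _ (\sum_(h <= i < n.+1) (2 * h)%N%:R)).
  by apply: ler_sum_nat => i; apply: row.
by rewrite sumr_const_nat -mulrnA ler_nat; nia.
Qed.

End ConditionalExpectation.

(** * Sieving a family of walks *)

Lemma exp2_size_primes (n : nat) : (0 < n)%N -> (2 ^ size (primes n) <= n)%N.
Proof.
move=> n0; rewrite {2}(prod_prime_decomp n0) prime_decompE big_map.
have : all (fun p => prime p && (p %| n))%N (primes n).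
  by apply/allP => p; rewrite mem_primes => /and3P[-> _ ->].
elim: (primes n) => [|p s IH] /=; first by rewrite big_nil.
move=> /andP[/andP[pp pn] /IH {}IH]; rewrite big_cons /= expnS leq_mul //.
have l1 : (0 < logn p n)%N by rewrite logn_gt0 mem_primes pp n0.
apply: (@leq_trans (p ^ 1)); first by rewrite expn1 prime_gt1.
by rewrite leq_exp2l ?prime_gt1.
Qed.

(** With [w] distinct prime divisors, [2 ^ w <= n <= k ^ 6 <= 2 ^ (6 * k)]. This crude count
    suffices, since it gets multiplied by an error of order [1 / k ^ 2]. *)
Lemma prime_divisors_le (N n k : nat) : (0 < n)%N -> (n <= k ^ 6)%N ->
  (\sum_(N <= p < n.+1 | prime p && (p %| n)) 1 <= 6 * k)%N.
Proof.
move=> n0 nk; rewrite sum1_count -size_filter.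
apply: (@leq_trans (size (primes n))).
  apply: uniq_leq_size; first by rewrite filter_uniq // iota_uniq.
  by move=> p; rewrite mem_filter mem_primes n0 => /andP[].
rewrite -(@leq_exp2l 2) //; apply: (leq_trans (exp2_size_primes n n0)).
apply: (leq_trans nk); rewrite mulnC expnM leq_exp2r //.
exact/ltnW/ltn_expl.
Qed.

(** Telescoping, from [1 / p ^ 2 <= 1 / (p - 1) - 1 / p]. *)
Lemma sum_inv_sqr_le (R : realType) (N n : nat) : (0 < N)%N ->
  \sum_(N.+1 <= p < n) (p%:R ^+ 2)^-1 <= N%:R^-1 :> R.
Proof.
move=> N0; have [nN|Nn] := leqP n N.+1.
  by rewrite big_geq // invr_ge0.
apply: (@le_trans _ _ (N%:R^-1 - n.-1%:R^-1)); last by rewrite gerBl invr_ge0.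
have -> : (N%:R^-1 - n.-1%:R^-1 : R) = \sum_(N.+1 <= p < n) (p.-1%:R^-1 - p%:R^-1).
  case: n Nn => // n Nn; have Nn' : (N <= n)%N by lia.
  rewrite big_add1 /=.
  rewrite -[LHS]opprB -(telescope_sumr (fun p => p%:R^-1) Nn') -sumrN.
  by apply: eq_bigr => p _; rewrite opprB.
apply: ler_sum_nat => p /andP[Np _]; case: p Np => // p Np /=.
have p0 : 0 < p%:R :> R by rewrite ltr0n; lia.
rewrite -natr1.
have -> : p%:R^-1 - (p%:R + 1)^-1 = (p%:R * (p%:R + 1))^-1 :> R by field; rewrite !gt_eqF; lra.
by rewrite lef_pV2 ?posrE; nra.
Qed.

Lemma prod01 (R : realType) (I : Type) (s : seq I) (P : pred I) (x : I -> R) :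
  (forall i, P i -> 0 <= x i <= 1) -> 0 <= \prod_(i <- s | P i) x i <= 1.
Proof.
move=> x01; apply: (big_ind (fun u => 0 <= u <= 1)) => //.
  by rewrite ler01 lexx.
by move=> u v /andP[? ?] /andP[? ?]; rewrite mulr_ge0 //= mulr_ile1.
Qed.

Lemma prod_dist_le (R : realType) (I : Type) (s : seq I) (x y : I -> R) :
  (forall i, 0 <= x i <= 1) -> (forall i, 0 <= y i <= 1) ->
  `|\prod_(i <- s) x i - \prod_(i <- s) y i| <= \sum_(i <- s) `|x i - y i|.
Proof.
move=> x01 y01.
elim: s => [|i s IH]; first by rewrite !big_nil subrr normr0.
rewrite !big_cons; set X := \prod_(j <- s) x j in IH *; set Y := \prod_(j <- s) y j in IH *.
have -> : x i * X - y i * Y = (x i - y i) * Y + x i * (X - Y) by ring.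
apply: (le_trans (ler_normD _ _)); rewrite !normrM; apply: lerD.
  have /andP[Y0 Y1] := prod01 R I s xpredT y (fun i _ => y01 i).
  by rewrite -[leRHS]mulr1 ler_wpM2l // ger0_norm.
have /andP[xi0 xi1] := x01 i; apply: le_trans IH.
by rewrite -[leRHS]mul1r ler_wpM2r // ger0_norm.
Qed.

Section VectorWalk.
Context (R : realType) (r : nat) (a : 'I_r -> R).
Hypothesis a01 : forall j, 0 < a j < 1.

(** The simultaneous steps of all [r] walks form one letter, so the family becomes a single sequence
    of independent letters. *)
Definition letter := {ffun 'I_r -> bool}.

Definition letter_wt (c : letter) : R := \prod_j (if c j then a j else 1 - a j).

Lemma letter_wt_ge0 c : 0 <= letter_wt c.
Proof.
by apply: prodr_ge0 => j _; have /andP[? ?] := a01 j; case: (c j); lra.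
Qed.

(** Independence of the walks within one step: distributing the product over the sums gives the sum
    over all letters. *)
Lemma sum_letter_wt (g : 'I_r -> bool -> R) :
  \sum_c letter_wt c * \prod_j g j (c j) =
  \prod_j ((1 - a j) * g j false + a j * g j true).
Proof.
transitivity (\sum_(c : letter) \prod_j ((if c j then a j else 1 - a j) * g j (c j))).
  by apply: eq_bigr => c _; rewrite big_split.
rewrite -(bigA_distr_bigA (fun j b => (if b then a j else 1 - a j) * g j b)).
by apply: eq_bigr => j _; rewrite big_bool /= addrC.
Qed.

Lemma letter_wt_sum1 : \sum_c letter_wt c = 1.
Proof.
transitivity (\prod_(j < r) ((1 - a j) * 1 + a j * 1)).
  rewrite -(sum_letter_wt (fun _ _ => 1)); apply: eq_bigr => c _.
  by rewrite big1 ?mulr1.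
by apply: big1 => j _; ring.
Qed.

Definition height (j : 'I_r) (s : seq letter) : nat := count (fun c : letter => c j) s.

Lemma height_rcons j s c : height j (rcons s c) = (height j s + c j)%N.
Proof. by rewrite /height -cats1 count_cat /= addn0. Qed.

Notation E := (cexp R letter letter_wt).

(** By [sum_letter_wt], one letter acts on a product over the walks factor by factor through
    [bstep]; given the past, the heights advance by independent binomial increments. *)
Lemma cexp_prod_height h (f : 'I_r -> nat -> R) s :
  E h (fun s => \prod_j f j (height j s)) s =
  \prod_j iter h (bstep R (a j)) (f j) (height j s).
Proof.
elim: h s => [|h IH] s //=.
under eq_bigr => c _ do rewrite IH.
under eq_bigr => c _ do under eq_bigr => j _ do rewrite height_rcons.
rewrite (sum_letter_wt (fun j b => iter h (bstep R (a j)) (f j) (height j s + b)%N)).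
by apply: eq_bigr => j _; rewrite addn0 addn1.
Qed.

Lemma cexp_height h j (f : nat -> R) s :
  E h (fun s => f (height j s)) s = iter h (bstep R (a j)) f (height j s).
Proof.
have := cexp_prod_height h (fun i => if i == j then f else fun=> 1) s.
rewrite (bigD1 j) //= eqxx big1 ?mulr1 => [<-|i /negPf ->]; last exact: bsteps_const.
apply: eq_cexp; [exact: letter_wt_ge0 | move=> s' _].
by rewrite (bigD1 j) //= eqxx big1 ?mulr1 // => i /negPf ->.
Qed.

(** * Sieve by small primes and its means *)

Context (e e' : nat).
Hypothesis e_gt0 : (0 < e)%N.
Hypothesis e'_gt0 : (0 < e')%N.

Definition prime_hit (i z p : nat) : bool := (p ^ e %| i)%N && (p ^ e' %| z)%N.

(** Made decidable by testing only [p <= size s]: a prime that hits divides the size, so for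
    nonempty [s] nothing is missed ([unhitP]). *)
Definition unhit (s : seq letter) : bool :=
  [forall j, all (fun p => prime p ==> ~~ prime_hit (size s) (height j s) p)
    (iota 0 (size s).+1)].

Lemma unhitP s : (0 < size s)%N ->
  reflect (forall j p, prime p -> ~~ prime_hit (size s) (height j s) p) (unhit s).
Proof.
move=> s0; apply: (iffP forallP) => [H j p pp|H j]; last first.
  by apply/allP => p _; apply/implyP => /H.
apply/negP => hp; have /allP/(_ p) := H j; rewrite mem_iota add0n ltnS pp hp /= => ps.
have /andP[pe _] := hp; have pi : (p %| size s)%N by apply: dvdn_trans pe; apply: dvdn_exp.
by have := ps (dvdn_leq s0 pi).
Qed.

Definition sieve (N i z : nat) : R :=
  \prod_(p < N | prime p) (if prime_hit i z p then 0 else 1).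

(** The probability of surviving the sieve at time [i] if the [r] heights were independent and
    exactly equidistributed modulo [primorial e' N]. *)
Definition sieve_mean (N i : nat) : R :=
  \prod_(p < N | prime p)
    (if (p ^ e %| i)%N then (1 - (p%:R ^+ e')^-1) ^+ r else 1).

Lemma prime_factor01 p : prime p -> 0 <= 1 - ((p%:R : R) ^+ e')^-1 <= 1.
Proof.
move=> pp; have p1 : 1 <= p%:R ^+ e' :> R by rewrite -natrX ler1n expn_gt0 prime_gt0.
have p0 : 0 < p%:R ^+ e' :> R by apply: lt_le_trans p1.
by rewrite subr_ge0 invf_le1 //= p1 gerBl invr_ge0 ltW.
Qed.

Lemma sieve01 N i z : 0 <= sieve N i z <= 1.
Proof.
by apply: prod01 => p _; case: ifP; rewrite ?lexx ?ler01.
Qed.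

Lemma sieve_periodic_mean N i :
  periodic R (primorial e' N) (sieve N i) /\
  mean R (primorial e' N) (sieve N i) =
  \prod_(p < N | prime p) (if (p ^ e %| i)%N then 1 - (p%:R ^+ e')^-1 else 1).
Proof.
pose F p z : R := if prime_hit i z p then 0 else 1.
have FE p z : F p z = if (p ^ e' %| z)%N then (if (p ^ e %| i)%N then 0 else 1) else 1.
  by rewrite /F /prime_hit; case: (_ %| i)%N; case: (_ %| z)%N.
have FE' p : F p = fun z => if (p ^ e' %| z)%N then (if (p ^ e %| i)%N then 0 else 1) else 1.
  by apply/funext => z.
have pF p : prime p -> periodic R (p ^ e') (F p).
  by move=> _; rewrite FE'; apply: periodic_dvd.
have [H1 H2] := mean_prod_primes R e' N F pF; split; first exact: H1.
apply: (etrans H2); apply: eq_bigr => p pp; rewrite FE' mean_dvd ?expn_gt0 ?prime_gt0 //.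
by rewrite natrX; case: ifP => _; rewrite ?mulr0 ?addr0 // mulr1 subrK.
Qed.

(** The second averaging, over the time [i] instead of the height: [mean_dvd] turns each local
    factor into the factor of the Euler product. *)
Lemma sieve_mean_euler N :
  [/\ periodic R (primorial e N) (sieve_mean N),
      forall i, 0 <= sieve_mean N i <= 1 &
      mean R (primorial e N) (sieve_mean N) =
      \prod_(p < N | prime p)
        (1 - (p%:R ^+ e)^-1 + (p%:R ^+ e)^-1 * (1 - (p%:R ^+ e')^-1) ^+ r)].
Proof.
pose F p z : R := if (p ^ e %| z)%N then (1 - (p%:R ^+ e')^-1) ^+ r else 1.
have pF p : prime p -> periodic R (p ^ e) (F p) by move=> _; apply: periodic_dvd.
have [H1 H2] := mean_prod_primes R e N F pF; split; first exact: H1.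
- move=> i; apply: prod01 => p pp; case: ifP => _; last by rewrite ler01 lexx.
  have /andP[v0 v1] := prime_factor01 p pp.
  by rewrite exprn_ge0 //= exprn_ile1.
- apply: (etrans H2); apply: eq_bigr => p pp.
  by rewrite mean_dvd ?expn_gt0 ?prime_gt0 // natrX.
Qed.

(** The two sides can differ only when some prime [p >= N] hits. Such a [p] divides both the size
    and some height, hence contributes at least [1] on the right. Weakening the exponents to [1] is
    affordable because the sum of [1 / p ^ 2] already converges. *)
Lemma unhit_sieve N s : (0 < size s)%N ->
  `|(unhit s)%:R - \prod_j sieve N (size s) (height j s)| <=
  \sum_(N <= p < (size s).+1 | prime p && (p %| size s)%N)
    \sum_j (p %| height j s)%N%:R :> R.
Proof.
move=> s0; set P := \prod_j _; set S := \sum_(_ <= _ < _ | _) _.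
have S0 : 0 <= S by apply: sumr_ge0 => p _; apply: sumr_ge0.
have P01 : 0 <= P <= 1.
  by apply: prod01 => j _; apply: sieve01.
have [H|nH] := unhitP s s0.
  rewrite (_ : P = 1) ?subrr ?normr0 //.
  apply: big1 => j _; apply: big1 => p pp.
  by rewrite (negPf (H j p pp)).
have [j [p [pp hp]]] : exists j p, prime p /\ prime_hit (size s) (height j s) p.
  apply: contrapT => nex; apply: nH => j p pp; apply/negP => hp; apply: nex.
  by exists j, p.
have [pN|Np] := ltnP p N.
  rewrite (_ : P = 0) ?subrr ?normr0 // /P (bigD1 j) //= /sieve.
  by rewrite (bigD1 (Ordinal pN)) //= hp !mul0r.
have /andP[pe pe'] := hp.
have pi : (p %| size s)%N by apply: dvdn_trans pe; apply: dvdn_exp.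
have pz : (p %| height j s)%N by apply: dvdn_trans pe'; apply: dvdn_exp.
rewrite sub0r normrN ger0_norm; last by case/andP: P01.
apply: (@le_trans _ _ 1); first by case/andP: P01.
have pin : p \in index_iota N (size s).+1 by rewrite mem_index_iota Np ltnS dvdn_leq.
rewrite /S big_mkcond (bigD1_seq p pin (iota_uniq _ _)) pp pi (bigD1 j) //= pz.
rewrite -addrA lerDl addr_ge0 // sumr_ge0 // => q _; case: ifP => // _.
exact: sumr_ge0.
Qed.

Context (kappa : R).
Hypothesis kappa_ge : forall j, (a j * (1 - a j))^-1 <= kappa.

(** Two errors add up: primes [p >= N] are discarded at the cost given by [unhit_sieve] and
    [bsteps_dvd], and the sieve by [p < N] is replaced by its mean, walk by walk, through
    [bsteps_periodic]. *)
Lemma cexp_unhit_sieve_mean (N h t : nat) s : (0 < t)%N -> (t ^ 2 <= h)%N ->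
  `|E h (fun s => (unhit s)%:R) s - sieve_mean N (size s + h)| <=
  r%:R * ((primorial e' N)%:R * (kappa / t%:R)) +
  \sum_(N <= p < (size s + h).+1 | prime p && (p %| size s + h)%N)
     (r%:R * (p%:R^-1 + kappa / t%:R)).
Proof.
move=> t0 th; set i := (size s + h)%N.
have i0 : (0 < i)%N by rewrite /i; nia.
have t0' : 0 < t%:R :> R by rewrite ltr0n.
have kD j : (a j * (1 - a j))^-1 / t%:R <= kappa / t%:R.
  by rewrite ler_wpM2r // invr_ge0 ltW.
have wt0 := letter_wt_ge0; have wt1 := letter_wt_sum1.
have sumjE (c : R) : r%:R * c = \sum_(j < r) c.
  by rewrite sumr_const card_ord mulr_natl.
have tail : `|E h (fun s => (unhit s)%:R) s -
    E h (fun s => \prod_j sieve N i (height j s)) s| <=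
    \sum_(N <= p < i.+1 | prime p && (p %| i)%N) (r%:R * (p%:R^-1 + kappa / t%:R)).
  rewrite -cexpB.
  apply: (@le_trans _ _ (E h (fun s' => \sum_(N <= p < i.+1 | prime p && (p %| i)%N)
    \sum_j (p %| height j s')%N%:R) s)).
    have key s' : size s' = i ->
       `|(unhit s')%:R - \prod_j sieve N i (height j s')| <=
       \sum_(N <= p < i.+1 | prime p && (p %| i)%N) \sum_j (p %| height j s')%N%:R :> R.
      by move=> es; rewrite -es; apply: unhit_sieve; rewrite es.
    rewrite ler_norml; apply/andP; split.
      rewrite -[leLHS]sub0r -[X in X - _](cexp_const R letter letter_wt wt1 h 0 s).
      rewrite -cexpB; apply: le_cexp => // s' es; have := key s' es.
      by rewrite ler_norml => /andP[? _]; lra.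
    apply: le_cexp => // s' es; have := key s' es.
    by rewrite ler_norml => /andP[].
  rewrite cexp_sum; apply: ler_sum => p /andP[pp _]; rewrite cexp_sum sumjE.
  apply: ler_sum => j _.
  rewrite (cexp_height h j (fun z => (p %| z)%N%:R)).
  have := bsteps_dvd R (a j) (a01 j) h t p (height j s) t0 th (prime_gt0 pp).
  by move=> le1; apply: (le_trans le1); rewrite lerD2l.
rewrite [leRHS]addrC; apply: (@le_trans _ _ (`|E h (fun s => (unhit s)%:R) s -
    E h (fun s => \prod_j sieve N i (height j s)) s| +
    `|E h (fun s => \prod_j sieve N i (height j s)) s - sieve_mean N i|)).
  exact: ler_distD.
apply: lerD => //.
have [pS mS] := sieve_periodic_mean N i.
(* The [r]-th power moves outside the product over primes, since the factors with [p ^ e] not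
   dividing [i] equal [1]. *)
have -> : sieve_mean N i = \prod_(j < r) mean R (primorial e' N) (sieve N i).
  rewrite prodr_const card_ord mS -prodrXl; apply: eq_bigr => p _.
  by case: ifP => _; rewrite ?expr1n.
rewrite (cexp_prod_height h (fun=> sieve N i)).
have mean01 : 0 <= mean R (primorial e' N) (sieve N i) <= 1.
  rewrite mS; apply: prod01 => p pp; case: ifP => _; last by rewrite ler01 lexx.
  exact: prime_factor01.
apply: (le_trans (prod_dist_le _ _ _ _ _ _ _)) => //.
  by move=> j; apply: bsteps01 => // z; apply: sieve01.
rewrite sumjE; apply: ler_sum => j _.
apply: (le_trans (bsteps_periodic R (a j) (a01 j) h t _ _ _ t0 th _ pS _)).
- exact: primorial_gt0.
- by move=> z; apply: sieve01.
- by rewrite ler_wpM2l.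
Qed.

Hypothesis kappa_ge0 : 0 <= kappa.

(** After exchanging the sums, each [p] has at most [n / p] multiples up to [n], which leaves [n]
    times a tail of the sum of [1 / p ^ 2]. *)
Lemma sum_prime_divisors_inv (N h n : nat) : (0 < N)%N -> (0 < h)%N ->
  \sum_(h <= i < n.+1) \sum_(N.+1 <= p < i.+1 | prime p && (p %| i)%N) (p%:R^-1 : R)
  <= n%:R / N%:R.
Proof.
move=> N0 h0.
apply: (@le_trans _ _ (\sum_(1 <= i < n.+1) \sum_(N.+1 <= p < n.+1)
    (p %| i)%N%:R * p%:R^-1)).
  have [hn|nh] := leqP h n.+1; last first.
    rewrite [leLHS]big_geq 1?ltnW //; apply: sumr_ge0 => i _; apply: sumr_ge0 => p _.
    by rewrite mulr_ge0 // invr_ge0.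
  rewrite [leRHS](@big_cat_nat _ _ _ h) //=.
  rewrite -[leLHS]add0r lerD //.
    by apply: sumr_ge0 => i _; apply: sumr_ge0 => p _; rewrite mulr_ge0 // invr_ge0.
  apply: ler_sum_nat => i /andP[hi iN].
  have [Ni|iN'] := leqP N.+1 i.+1; last first.
    rewrite [leLHS]big_geq 1?ltnW //; apply: sumr_ge0 => p _.
    by rewrite mulr_ge0 // invr_ge0.
  rewrite [leRHS](@big_cat_nat _ _ _ i.+1) //= -[leLHS]addr0 lerD //; last first.
    by apply: sumr_ge0 => p _; rewrite mulr_ge0 // invr_ge0.
  rewrite big_mkcond; apply: ler_sum => p _.
  case: ifP => [/andP[_ ->]|_]; first by rewrite mul1r.
  by rewrite mulr_ge0 // invr_ge0.
rewrite exchange_big /=.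
apply: (@le_trans _ _ (\sum_(N.+1 <= p < n.+1) n%:R * (p%:R ^+ 2)^-1)).
  apply: ler_sum_nat => p /andP[Np _].
  have p0 : 0 < p%:R :> R by rewrite ltr0n; lia.
  rewrite -mulr_suml -natr_sum -divn_count_dvd.
  rewrite expr2 invfM mulrA; apply: ler_wpM2r; first by rewrite invr_ge0 ltW.
  by rewrite ler_pdivlMr // -natrM ler_nat leq_trunc_div.
by rewrite -mulr_sumr ler_wpM2l // sum_inv_sqr_le.
Qed.

(** The deterministic part of the argument, with [n = k ^ 6], window [h = k ^ 4] and [t = k ^ 2]:
    apart from the recentred sum and the large-prime cost [r / N], every relative error is
    [O(1 / k)] for fixed [N]. *)
Lemma unhit_average_bound (N k : nat) (s : seq letter) :
  (0 < N)%N -> (0 < k)%N -> size s = (k ^ 6)%N ->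
  `|\sum_(1 <= i < (k ^ 6).+1) (unhit (take i s))%:R - (k ^ 6)%:R *
     \prod_(p < N.+1 | prime p)
        (1 - (p%:R ^+ e)^-1 + (p%:R ^+ e)^-1 * (1 - (p%:R ^+ e')^-1) ^+ r)| <=
  `|\sum_(k ^ 4 <= i < (k ^ 6).+1)
      recentred R letter letter_wt (k ^ 4) (fun s => (unhit s)%:R) i s| +
  (k ^ 6)%:R * (r%:R / N%:R + (1 + (primorial e N.+1)%:R +
     r%:R * (primorial e' N.+1)%:R * kappa + 6 * r%:R * kappa) / k%:R).
Proof.
move=> N0 k0 es; have [pm m01 <-] := sieve_mean_euler N.+1.
set n := (k ^ 6)%N; set h := (k ^ 4)%N; set M := primorial e' N.+1.
set y := sieve_mean N.+1; set D := kappa / (k ^ 2)%:R.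
have h0 : (0 < h)%N by rewrite expn_gt0 k0.
have hn : (h <= n)%N by rewrite leq_pexp2l.
have D0 : 0 <= D by rewrite divr_ge0.
pose Y i : R := (unhit (take i s))%:R.
pose X i := recentred R letter letter_wt h (fun s => (unhit s)%:R) i s.
pose G i := E h (fun s => (unhit s)%:R) (take (i - h) s).
have XE i : Y i - y i = X i + (G i - y i) by rewrite /X /recentred -/(Y i) -/(G i); ring.
(* The times before the first full window are bounded trivially; their total [h = k ^ 4] is at most
   [n / k]. *)
have early : `|\sum_(1 <= i < h) (Y i - y i)| <= h%:R.
  apply: (le_trans (ler_norm_sum _ _ _)).
  apply: (@le_trans _ _ (\sum_(1 <= i < h) 1)).
    apply: ler_sum => i _; have /andP[y0 y1] := m01 i.
    by rewrite ler_norml /Y -/y in y0 y1 *; case: (unhit _) => /=; lra.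
  by rewrite sumr_const_nat ler_nat leq_subr.
(* The terms on the right come, in order, from equidistribution modulo the primorial, from [1 / p]
   summed over large prime divisors, and from the error [D] incurred for at most [6 * k] prime
   divisors of each [i]. *)
have late : `|\sum_(h <= i < n.+1) (G i - y i)| <=
    n%:R * (r%:R * (M%:R * D)) + r%:R * (n%:R / N%:R) + r%:R * (n%:R * ((6 * k)%:R * D)).
  apply: (le_trans (ler_norm_sum _ _ _)).
  apply: (@le_trans _ _ (\sum_(h <= i < n.+1) (r%:R * (M%:R * D) +
     r%:R * (\sum_(N.+1 <= p < i.+1 | prime p && (p %| i)%N) (p%:R^-1 : R)) +
     r%:R * ((6 * k)%:R * D)))).
    apply: ler_sum_nat => i /andP[hi iN].
    have sz : (size (take (i - h) s) + h = i)%N.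
      by rewrite size_takel ?es; lia.
    have t0 : (0 < k ^ 2)%N by rewrite expn_gt0 k0.
    have th : ((k ^ 2) ^ 2 <= h)%N by rewrite -expnM.
    have := cexp_unhit_sieve_mean N.+1 h (k ^ 2) (take (i - h) s) t0 th.
    rewrite sz -/(G i) -/y -/D => le1; apply: (le_trans le1).
    rewrite -addrA lerD2l -mulr_sumr -mulrDr ler_wpM2l // big_split /= lerD2l.
    have -> : \sum_(N.+1 <= p < i.+1 | prime p && (p %| i)%N) D =
        (\sum_(N.+1 <= p < i.+1 | prime p && (p %| i)) 1)%N%:R * D.
      by rewrite natr_sum mulr_suml; apply: eq_bigr => p _; rewrite mul1r.
    apply: ler_wpM2r => //; rewrite ler_nat; apply: prime_divisors_le; first by lia.
    by rewrite -ltnS.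
  have cnt (c : R) : 0 <= c -> \sum_(h <= i < n.+1) c <= n%:R * c.
    by move=> c0; rewrite sumr_const_nat -[leLHS]mulr_natl ler_wpM2r // ler_nat; lia.
  rewrite !big_split /=; apply: lerD; first apply: lerD.
  - by apply: cnt; rewrite !mulr_ge0.
  - by rewrite -mulr_sumr ler_wpM2l // sum_prime_divisors_inv.
  - by rewrite [leRHS]mulrCA; apply: cnt; rewrite !mulr_ge0.
have per : `|\sum_(1 <= i < n.+1) y i - n%:R * mean R (primorial e N.+1) y| <=
    (primorial e N.+1)%:R.
  rewrite big_add1 /= big_mkord.
  exact: (sum_periodic_mean R _ n 1 y (primorial_gt0 _ _) pm m01).
have -> : \sum_(1 <= i < n.+1) (unhit (take i s))%:R =
   \sum_(1 <= i < h) (Y i - y i) + (\sum_(h <= i < n.+1) X i +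
   \sum_(h <= i < n.+1) (G i - y i)) + \sum_(1 <= i < n.+1) y i.
  rewrite -big_split /= -(eq_bigr _ (fun i _ => XE i)) -big_cat_nat //=; last exact: leqW.
  by rewrite sumrB subrK.
rewrite -/(X _).
set A := \sum_(1 <= i < h) _ in early *; set B := \sum_(h <= i < n.+1) X i.
set F := \sum_(h <= i < n.+1) (G i - y i) in late *.
set mu := mean R _ _ in per *; set S := \sum_(1 <= i < n.+1) y i in per *.
have k1 : 1 <= k%:R :> R by rewrite ler1n.
have kp : 0 < k%:R :> R by rewrite ltr0n.
have kn0 : k%:R != 0 :> R by rewrite gt_eqF.
have nE : n%:R = k%:R ^+ 6 :> R by rewrite /n natrX.
have hE : h%:R = k%:R ^+ 4 :> R by rewrite /h natrX.
have DE : D = kappa / k%:R ^+ 2 by rewrite /D natrX.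
have n5 : n%:R * k%:R^-1 = k%:R ^+ 5 :> R by rewrite nE exprSr mulfK.
have le_hn : h%:R <= n%:R * k%:R^-1 :> R by rewrite n5 hE; apply: ler_weXn2l.
have le_Mn : (primorial e N.+1)%:R <= n%:R * ((primorial e N.+1)%:R / k%:R) :> R.
  by rewrite mulrCA n5 ler_peMr // exprn_ege1.
have le_rM : n%:R * (r%:R * (M%:R * D)) <= n%:R * (r%:R * M%:R * kappa / k%:R) :> R.
  rewrite ler_wpM2l // -!mulrA ler_wpM2l // ler_wpM2l // DE ler_wpM2l //.
  by rewrite lef_pV2 ?posrE ?exprn_gt0 // expr2 ler_peMl.
have e6 : r%:R * (n%:R * ((6 * k)%:R * D)) = n%:R * (6 * r%:R * kappa / k%:R).
  by rewrite DE natrM; field.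
have tri : `|A + (B + F) + S - n%:R * mu| <= `|A| + (`|B| + `|F|) + `|S - n%:R * mu|.
  rewrite -addrA; apply: (le_trans (ler_normD _ _)); rewrite lerD2r.
  by apply: (le_trans (ler_normD _ _)); rewrite lerD2l ler_normD.
apply: (le_trans tri).
have -> : n%:R * (r%:R / N%:R + (1 + (primorial e N.+1)%:R +
     r%:R * M%:R * kappa + 6 * r%:R * kappa) / k%:R) =
   r%:R * (n%:R / N%:R) + n%:R * k%:R^-1 + n%:R * ((primorial e N.+1)%:R / k%:R)
   + n%:R * (r%:R * M%:R * kappa / k%:R) + n%:R * (6 * r%:R * kappa / k%:R) by ring.
rewrite -e6; lra.
Qed.

End VectorWalk.

(** * Random words *)

(** Unfolds the letter-by-letter recursion into one sum over words, the form in which it can be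
    compared with an integral. *)
Lemma cexp_tuple_sum (R : realType) (C : finType) (wt : C -> R) n F s :
  cexp R C wt n F s = \sum_(v : n.-tuple C) (\prod_(c <- v) wt c) * F (s ++ v).
Proof.
elim: n s => [|n IH] s.
  rewrite (big_pred1 [tuple]) ?big_nil ?mul1r ?cats0 // => v.
  by rewrite /=; apply/esym/eqP; exact: tuple0.
pose cns (p : C * n.-tuple C) : n.+1.-tuple C := [tuple of p.1 :: p.2].
rewrite (reindex cns) /=; last first.
  exists (fun t => (thead t, [tuple of behead t])).
    by case=> c v _; congr (_, _); apply/val_inj.
  by move=> t _; rewrite /cns /=; case/tupleP: t => c v; apply/val_inj.
rewrite -(pair_big xpredT xpredT (fun c (v : n.-tuple C) =>
  (\prod_(x <- c :: v) wt x) * F (s ++ c :: v))) /=.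
apply: eq_bigr => c _; rewrite IH mulr_sumr; apply: eq_bigr => v _.
by rewrite big_cons mulrA cat_rcons.
Qed.

Section LetterProcess.
Context (R : realType) (d : measure_display) (T : measurableType d).
Context (P : probability T R) (C : finType) (wt : C -> R) (L : nat -> T -> C).

Definition prefix (n : nat) (w : T) : seq C := mkseq (L^~ w) n.

Hypothesis L_meas : forall k c, measurable [set w | L k w = c].
Hypothesis prefix_law : forall s : seq C,
  P [set w | prefix (size s) w = s] = (\prod_(c <- s) wt c)%:E.

Lemma take_prefix i n w : (i <= n)%N -> take i (prefix n w) = prefix i w.
Proof. by move=> le_in; rewrite /prefix /mkseq -map_take take_iota (minn_idPl le_in). Qed.

Lemma measurable_prefix n s : measurable [set w | prefix n w = s].
Proof.
elim: n s => [|n IH] s.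
  case: s => [|c s].
    by rewrite (_ : [set w | _] = setT) //; apply/seteqP.
  by rewrite (_ : [set w | _] = set0) //; apply/seteqP; split.
case/lastP: s => [|s c].
  by rewrite (_ : [set w | _] = set0) //; apply/seteqP; split.
rewrite (_ : [set w | _] = [set w | prefix n w = s] `&` [set w | L n w = c]).
  exact: measurableI.
apply/seteqP; split=> w /=.
  by rewrite /prefix mkseqS => /rcons_inj[-> ->].
by move=> [e1 e2]; rewrite /prefix mkseqS e2 -e1.
Qed.

(** Functions of the prefix are finite simple functions; measurability and integrals are read off
    from this form. *)
Lemma prefix_fun_indic n (F : seq C -> R) w :
  F (prefix n w) = \sum_(v : n.-tuple C) F v * \1_[set w | prefix n w = v] w.
Proof.
have sz : size (prefix n w) == n by rewrite size_mkseq.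
rewrite (bigD1 (Tuple sz)) //= indicE mem_set // mulr1 big1 ?addr0 // => v nv.
rewrite indicE memNset ?mulr0 //= => e; move/eqP: nv; apply; apply/val_inj.
by rewrite /= e.
Qed.

Lemma measurable_prefix_fun n (F : seq C -> R) :
  measurable_fun setT (fun w => F (prefix n w)).
Proof.
under eq_fun do rewrite prefix_fun_indic.
apply: measurable_sum => v; apply: measurable_funM; first exact: measurable_cst.
exact/measurable_indicP/measurable_prefix.
Qed.

Lemma integral_prefix n (F : seq C -> R) : (forall s, 0 <= F s) ->
  (\int[P]_w (F (prefix n w))%:E = (cexp R C wt n F [::])%:E)%E.
Proof.
move=> F0; rewrite cexp_tuple_sum.
under eq_integral => w _ do rewrite prefix_fun_indic -sumEFin.
rewrite ge0_integral_sum //.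
- rewrite -sumEFin; apply: eq_bigr => v _.
  under eq_integral => w _ do rewrite EFinM.
  rewrite ge0_integralZl //.
  + rewrite integral_indic // ?setIT; last exact: measurable_prefix.
    have := prefix_law v; rewrite size_tuple => PE.
    by rewrite mulrC EFinM; congr (_ * _)%E; exact: PE.
  + apply/measurable_EFinP; exact/measurable_indicP/measurable_prefix.
  + by rewrite lee_fin.
- move=> v; apply/measurable_EFinP; apply: measurable_funM; first exact: measurable_cst.
  exact/measurable_indicP/measurable_prefix.
- by move=> v w _; rewrite lee_fin mulr_ge0.
Qed.

End LetterProcess.

(** By monotone convergence the series of the [Z k] has finite integral, hence is finite almost
    everywhere, and the terms of a convergent series tend to zero. *)
Lemma ae_cvg0_summable (R : realType) (d : measure_display) (T : measurableType d)
    (P : probability T R) (Z : nat -> T -> R) (u : nat -> R) (B : R) :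
  (forall k, measurable_fun setT (Z k)) -> (forall k w, 0 <= Z k w) ->
  (forall k, \int[P]_w (Z k w)%:E <= (u k)%:E)%E ->
  (forall n, \sum_(0 <= k < n) u k <= B) ->
  {ae P, forall w, Z^~ w @ \oo --> 0}.
Proof.
move=> mZ Z0 Zu uB.
pose S w := (\sum_(0 <= k <oo) (Z k w)%:E)%E.
have mS : measurable_fun setT S.
  apply: ge0_emeasurable_sum => [k w _ _|k _]; first by rewrite lee_fin.
  exact/measurable_EFinP.
have S0 w : (0 <= S w)%E by apply: nneseries_ge0 => k _ _; rewrite lee_fin.
have iS : P.-integrable setT S.
  apply/integrableP; split => //.
  under eq_integral => w _ do rewrite gee0_abs //.
  rewrite /S integral_nneseries //;
    [|by move=> k; apply/measurable_EFinP|by move=> k w _; rewrite lee_fin].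
  apply: (@le_lt_trans _ _ B%:E); last exact: ltry.
  apply: lime_le.
    by apply: is_cvg_nneseries => k _ _; apply: integral_ge0 => w _; rewrite lee_fin.
  apply: nearW => n; apply: (@le_trans _ _ (\sum_(0 <= k < n) (u k)%:E)%E).
    by apply: lee_sum => k _.
  by rewrite sumEFin lee_fin.
have := integrable_ae measurableT iS; apply: filterS => w /(_ I) fS.
apply: cvg_series_cvg_0; apply: nondecreasing_is_cvgn.
  by apply/nondecreasing_seqP => n; rewrite /series /= big_nat_recr //= lerDl.
exists (fine (S w)) => _ [n _ <-].
rewrite -lee_fin fineK // /series /= -sumEFin.
by apply: nneseries_lim_ge => k _ _; rewrite lee_fin.
Qed.

(** * Averages along sixth powers *)

Lemma nat_pow6_bracket (n : nat) : (0 < n)%N ->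
  exists2 k, (0 < k)%N & (k ^ 6 <= n < k.+1 ^ 6)%N.
Proof.
elim: n => // n IH _; case: n IH => [_|n IH]; first by exists 1%N.
have [//|k k0 /andP[kn nk]] := IH.
have [lt|ge] := ltnP n.+2 (k.+1 ^ 6); first by exists k => //; rewrite (leq_trans kn) //.
exists k.+1 => //; rewrite ge /=.
have -> : n.+2 = (k.+1 ^ 6)%N by apply/eqP; rewrite eqn_leq ge andbT.
by rewrite ltn_exp2r.
Qed.

(* The averages along [m = k^6] and at [n < (k+1)^6] differ by at most
   [2 (n - m) / n], and [(k+1)^6 - k^6 <= 63 k^5]. *)
Lemma average_cvg_pow6 (R : realType) (y : nat -> R) (L : R) :
  (forall i, 0 <= y i <= 1) ->
  (fun k => (k ^ 6)%:R^-1 * \sum_(1 <= i < (k ^ 6).+1) y i) @ \oo --> L ->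
  (fun n => n%:R^-1 * \sum_(1 <= i < n.+1) y i) @ \oo --> L.
Proof.
move=> y01 /cvgrPdist_le cL; apply/cvgrPdist_le => eps eps0.
have [K _ hK] : \forall k \near \oo, `|L - (k ^ 6)%:R^-1 *
    \sum_(1 <= i < (k ^ 6).+1) y i| <= eps / 2 by apply: cL; rewrite divr_gt0.
(* [126 / k] leaves room for two corrections of at most [63 / k] each. *)
have [K' hK'] : exists K' : nat, forall k, (K' <= k)%N -> (0 < k)%N -> 126 / k%:R <= eps / 2.
  exists (Num.truncn (252 / eps)).+1 => k Kk k0.
  have k0' : 0 < k%:R :> R by rewrite ltr0n.
  rewrite ler_pdivrMr // mulrAC ler_pdivlMr //.
  have : 252 / eps < k%:R by apply: lt_le_trans (truncnS_gt _) _; rewrite ler_nat.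
  by rewrite ltr_pdivrMr // mulrC => /ltW; lra.
exists ((maxn K K').+1 ^ 6)%N => // n /= Kn.
have n0 : (0 < n)%N by apply: leq_trans Kn; rewrite expn_gt0.
have [k k0 /andP[kn nk]] := nat_pow6_bracket n n0.
have Kk : (maxn K K' <= k)%N.
  have : (((maxn K K').+1) ^ 6 < k.+1 ^ 6)%N by apply: leq_ltn_trans nk.
  by rewrite ltn_exp2r // ltnS => /ltnW.
set m := (k ^ 6)%N in kn hK *.
have hk : `|L - m%:R^-1 * \sum_(1 <= i < m.+1) y i| <= eps / 2.
  by apply: hK => /=; apply: leq_trans Kk; rewrite leq_maxl.
have hk' : 126 / k%:R <= eps / 2.
  by apply: hK' => //; apply: leq_trans Kk; rewrite leq_maxr.
have m0 : (0 < m)%N by rewrite expn_gt0 k0.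
have m0' : 0 < m%:R :> R by rewrite ltr0n.
have n0' : 0 < n%:R :> R by rewrite ltr0n.
have k0' : 0 < k%:R :> R by rewrite ltr0n.
have sum01 i j : (i <= j)%N -> 0 <= \sum_(i <= l < j) y l <= j%:R - i%:R.
  move=> ij; rewrite sumr_ge0 /=; last by move=> l _; case/andP: (y01 l).
  have <- : \sum_(i <= l < j) 1 = j%:R - i%:R :> R by rewrite sumr_const_nat natrB.
  by apply: ler_sum => l _; case/andP: (y01 l).
have -> : \sum_(1 <= i < n.+1) y i =
    \sum_(1 <= i < m.+1) y i + \sum_(m.+1 <= i < n.+1) y i by rewrite -big_cat_nat.
have /andP[A0 A1] := sum01 1%N m.+1 isT.
have /andP[B0 B1] := sum01 m.+1 n.+1 kn.
move: A0 A1 B0 B1 hk.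
set A := \sum_(1 <= i < m.+1) y i; set B := \sum_(m.+1 <= i < n.+1) y i => A0 A1 B0 B1 hk.
have mE : m%:R = k%:R ^+ 6 :> R by rewrite /m natrX.
have nm : n%:R - m%:R <= 63 * k%:R ^+ 5 :> R.
  have k1 : 1 <= k%:R :> R by rewrite ler1n.
  have : n%:R <= (k%:R + 1) ^+ 6 :> R by rewrite natr1 -natrX ler_nat ltnW.
  have p (i j : nat) : (i <= j)%N -> k%:R ^+ i <= k%:R ^+ j :> R by move=> ?; apply: ler_weXn2l.
  have -> : (k%:R + 1) ^+ 6 = k%:R ^+ 6 + 6 * k%:R ^+ 5 + 15 * k%:R ^+ 4 + 20 * k%:R ^+ 3
     + 15 * k%:R ^+ 2 + 6 * k%:R ^+ 1 + 1 * k%:R ^+ 0 :> R by ring.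
  rewrite mE; have := p 4%N 5%N isT; have := p 3%N 5%N isT; have := p 2%N 5%N isT.
  by have := p 1%N 5%N isT; have := p 0%N 5%N isT; lra.
have mn : m%:R <= n%:R :> R by rewrite ler_nat.
have d1 : (n%:R - m%:R) / n%:R <= 63 / k%:R :> R.
  apply: (@le_trans _ _ ((63 * k%:R ^+ 5) / m%:R)).
    apply: ler_pM; [by rewrite subr_ge0 | by rewrite invr_ge0 ltW | exact: nm |].
    by rewrite lef_pV2.
  by rewrite mE le_eqVlt; apply/orP; left; apply/eqP; field; rewrite gt_eqF.
(* Rescaling the old average from [m] to [n] gives the first correction, and the terms after [m]
   give the second. *)
have -> : L - n%:R^-1 * (A + B) = (L - m%:R^-1 * A) +
    (A / m%:R * ((n%:R - m%:R) / n%:R) - B / n%:R).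
  by field; rewrite !gt_eqF.
apply: (le_trans (ler_normD _ _)); rewrite [leRHS]splitr; apply: lerD => //.
apply: le_trans hk'.
have a1 : A / m%:R <= 1 by rewrite ler_pdivrMr // mul1r; move: A1; rewrite -[m.+1%:R]natr1; lra.
have a0 : 0 <= A / m%:R by rewrite divr_ge0 // ltW.
have b0 : 0 <= B / n%:R by rewrite divr_ge0 // ltW.
have b1 : B / n%:R <= (n%:R - m%:R) / n%:R.
  apply: ler_wpM2r; first by rewrite invr_ge0 ltW.
  by apply: (le_trans B1); rewrite -[m.+1%:R]natr1 -[n.+1%:R]natr1; lra.
have d0 : 0 <= (n%:R - m%:R) / n%:R :> R.
  by apply: divr_ge0; [rewrite subr_ge0 | exact: ltW].
set q := (n%:R - m%:R) / n%:R in b1 d0 d1 *; set x := A / m%:R in a0 a1 *.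
have xq : 0 <= x * q <= q by rewrite mulr_ge0 //= -[leRHS]mul1r ler_wpM2r.
have {xq}[xq0 xq1] := andP xq.
have -> : 126 / k%:R = 63 / k%:R + 63 / k%:R :> R by lra.
by rewrite ler_norml; apply/andP; split; lra.
Qed.

(** The two averages differ by at most [i0.+1 / n]. This absorbs the initial times at which some
    coordinate is still zero and [bvisibleP] does not apply. *)
Lemma average_cvg_eventually (R : realType) (y z : nat -> R) (i0 : nat) (L : R) :
  (forall i, 0 <= y i <= 1) -> (forall i, 0 <= z i <= 1) ->
  (forall i, (i0 <= i)%N -> y i = z i) ->
  (fun n => n%:R^-1 * \sum_(1 <= i < n.+1) y i) @ \oo --> L ->
  (fun n => n%:R^-1 * \sum_(1 <= i < n.+1) z i) @ \oo --> L.
Proof.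
move=> y01 z01 yz cy.
have -> : (fun n => n%:R^-1 * \sum_(1 <= i < n.+1) z i) =
    (fun n => n%:R^-1 * \sum_(1 <= i < n.+1) y i +
              n%:R^-1 * \sum_(1 <= i < n.+1) (z i - y i)).
  by apply/funext => n; rewrite -mulrDr sumrB addrC subrK.
rewrite -[L]addr0; apply: cvgD => //.
apply/cvgrPdist_le => eps eps0.
exists (Num.truncn (i0.+1%:R / eps)).+1 => // n /= Kn.
have n0' : 0 < n%:R :> R by rewrite ltr0n; apply: leq_trans Kn.
rewrite sub0r normrN normrM ger0_norm ?invr_ge0 // ler_pdivrMl //.
apply: (@le_trans _ _ i0.+1%:R); last first.
  have : i0.+1%:R / eps < n%:R by apply: lt_le_trans (truncnS_gt _) _; rewrite ler_nat.
  by rewrite ltr_pdivrMr // => /ltW.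
apply: (le_trans (ler_norm_sum _ _ _)).
have yz1 i : `|z i - y i| <= 1.
  by have := y01 i; have := z01 i; move=> /andP[? ?] /andP[? ?]; rewrite ler_norml; lra.
apply: (@le_trans _ _ (\sum_(1 <= i < i0.+1 + n.+1) `|z i - y i|)).
  rewrite [leRHS](@big_cat_nat _ _ _ n.+1) //=; last by rewrite leq_addl.
  by rewrite lerDl sumr_ge0.
rewrite (@big_cat_nat _ _ _ i0.+1) //=; last by rewrite leq_addr.
rewrite [X in _ + X]big1_seq ?addr0; last first.
  move=> i /andP[_]; rewrite mem_index_iota => /andP[ii _].
  by rewrite yz ?subrr ?normr0 // ltnW.
apply: (@le_trans _ _ (\sum_(1 <= i < i0.+1) 1)); first by apply: ler_sum.
by rewrite sumr_const_nat ler_nat subSS subn0.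
Qed.

(** All factors lie in [[0, 1]], so the partial products are nonincreasing and bounded below. *)
Lemma euler_partial_cvg (R : realType) (b1 b2 r : nat) :
  exists L : R, euler_partial R b1 b2 r @ \oo --> L.
Proof.
have ef p : prime p -> 0 <= efactor R b1 b2 r p <= 1.
  move=> pp; rewrite /efactor /=.
  have /andP[u0 u1] := prime_factor01 R (minn b1 b2) p pp.
  have /andP[v0 v1] := prime_factor01 R (maxn b1 b2) p pp.
  have w0 : 0 <= (1 - (p%:R ^+ maxn b1 b2)^-1) ^+ r :> R by rewrite exprn_ge0.
  have w1 : (1 - (p%:R ^+ maxn b1 b2)^-1) ^+ r <= 1 :> R by rewrite exprn_ile1.
  by apply/andP; split; nra.
have e0 N : 0 <= euler_partial R b1 b2 r N.
  by apply: prodr_ge0 => p pp; case/andP: (ef p pp).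
exists (limn (euler_partial R b1 b2 r)); apply: nonincreasing_is_cvgn.
  apply/nonincreasing_seqP => N.
  rewrite [leLHS]/euler_partial big_mkcond big_ord_recr /= -big_mkcond.
  rewrite -[leRHS]mulr1; apply: ler_wpM2l; first exact: e0.
  by case: ifP => // /ef/andP[].
by exists 0 => _ [N _ <-].
Qed.

(** * Words of independent steps *)

Section IndependentSteps.
Context (R : realType) (d : measure_display) (T : measurableType d).
Context (P : probability T R) (r : nat) (alpha : 'I_r -> R).
Context (step : 'I_r -> nat -> T -> bool).
Hypothesis step_meas : forall j i, measurable [set w | step j i w].
Hypothesis step_law : forall j i, P [set w | step j i w] = (alpha j)%:E.
Hypothesis step_indep : mutually_independent P (fun k : 'I_r * nat => step k.1 k.2).

Lemma measurable_step_eq j i b : measurable [set w | step j i w = b].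
Proof.
case: b; first exact: step_meas.
rewrite (_ : [set w | _] = ~` [set w | step j i w]); first exact: measurableC.
by apply/seteqP; split=> w /=; case: (step j i w).
Qed.

Lemma step_eq_law j i b :
  P [set w | step j i w = b] = (if b then alpha j else 1 - alpha j)%:E.
Proof.
case: b; first exact: step_law.
rewrite (_ : [set w | _] = ~` [set w | step j i w]).
  by rewrite probability_setC // step_law.
by apply/seteqP; split=> w /=; case: (step j i w).
Qed.

(** For every [n], the exceptional event forces the first [n] steps to equal [~~ b], which has
    probability [q ^ n] by independence. *)
Lemma ae_step_eq j b : 0 < alpha j < 1 -> {ae P, forall w, exists i, step j i w = b}.
Proof.
move=> /andP[a0 a1]; pose q := if b then 1 - alpha j else alpha j.
have q01 : 0 < q < 1 by rewrite /q; case: (b); lra.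
pose A := \bigcap_i [set w | step j i w = ~~ b].
have mA : measurable A by apply: bigcap_measurable => // i _; apply: measurable_step_eq.
have PA n : (P A <= (q ^+ n)%:E)%E.
  pose s := [seq (j, k) | k <- iota 0 n].
  have us : uniq s by rewrite map_inj_uniq ?iota_uniq // => k l [].
  have := step_indep s (fun=> ~~ b) us.
  rewrite (_ : (\prod_(k <- s) _)%E = (q ^+ n)%:E); last first.
    rewrite big_map.
    under eq_bigr => k _ do rewrite /= step_eq_law.
    rewrite prodEFin big_const_seq count_predT size_iota iter_mulr_1; congr (_ ^+ _)%:E.
    by rewrite /q; case: (b).
  move=> <-; apply: le_measure; rewrite ?inE //.
    rewrite (_ : [set w | _] = \bigcap_(k in [set` s]) [set w | step k.1 k.2 w = ~~ b]).
      apply: fin_bigcap_measurable => [|k _]; first exact: finite_seq.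
      exact: measurable_step_eq.
    apply/seteqP; split=> w /=; first by move/allP => H k /= /H /eqP.
    by move=> H; apply/allP => k ks; apply/eqP; exact: H.
  by move=> w Aw /=; apply/allP => _ /mapP[k _ ->] /=; apply/eqP; apply: Aw.
exists A; split=> //; last first.
  move=> w /= nex i _ /=; apply/eqP; rewrite -addbT eq_sym; apply/negPn/negP => ne.
  by apply: nex; exists i; move: ne; case: (step j i w); case: b {q q01 A mA PA}.
apply/eqP; rewrite eq_le measure_ge0 andbT; apply/lee_addgt0Pr => eps eps0.
rewrite add0e.
have /cvgrPdist_le/(_ eps eps0)[n _ /(_ n (leqnn n))] : (fun n => q ^+ n) @ \oo --> (0 : R).
  by apply: cvg_expr; rewrite ger0_norm; case/andP: q01 => // /ltW.
rewrite /= sub0r normrN => le; apply: (le_trans (PA n)); rewrite lee_fin.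
exact: le_trans (ler_norm _) le.
Qed.

(* [beta] is the direction of the coordinate carrying the larger exponent: a
   letter records, for each walk, whether that coordinate increases. *)
Context (beta : bool).

Definition step_letter (k : nat) (w : T) : letter r := [ffun j => step j k w == beta].

Definition step_prob (j : 'I_r) : R := if beta then alpha j else 1 - alpha j.

Lemma measurable_step_letter k c : measurable [set w | step_letter k w = c].
Proof.
rewrite (_ : [set w | _] = \bigcap_(j in [set: 'I_r]) [set w | step j k w = (c j == beta)]).
  by apply: fin_bigcap_measurable => [|j _]; [exact: finite_finset|exact: measurable_step_eq].
apply/seteqP; split=> w /=.
  by move=> <- j _ /=; rewrite ffunE; case: (step j k w); case: beta.
move=> H; apply/ffunP => j; rewrite ffunE (H j I).
by case: (c j); case: beta.
Qed.

Lemma step_letter_prefix_law (s : seq (letter r)) :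
  P [set w | prefix d T (letter r) step_letter (size s) w = s] =
  (\prod_(c <- s) letter_wt R r step_prob c)%:E.
Proof.
(* A default for [nth]; the times in [idx] stay below [size s]. The value [v] inverts [step_letter]:
   it is what each single step must be to spell [s]. *)
pose c0 : letter r := [ffun=> true].
pose v (k : 'I_r * nat) := (nth c0 s k.2) k.1 == beta.
pose idx := [seq (j, k) | k <- iota 0 (size s), j <- enum 'I_r].
have uidx : uniq idx.
  apply: allpairs_uniq; rewrite ?iota_uniq ?enum_uniq //.
  by move=> [k j] [k' j'] _ _ /= [-> ->].
transitivity (P [set w | all (fun k => step k.1 k.2 w == v k) idx]).
  congr (P _); apply/seteqP; split=> w /=.
    move=> es; apply/allP => _ /allpairsP[[k j] /= [ks _ ->]] /=; rewrite /v /=.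
    move: ks; rewrite mem_iota add0n /= => ks.
    rewrite -[in nth _ _ _]es nth_mkseq // ffunE.
    by case: (step j k w); case: beta.
  move=> /allP H; apply: (@eq_from_nth _ c0); rewrite size_mkseq // => k ks.
  rewrite nth_mkseq //; apply/ffunP => j; rewrite ffunE.
  have /H/eqP /= -> : (j, k) \in idx.
    by apply/allpairsP; exists (k, j); rewrite mem_iota mem_enum.
  by rewrite /v /=; case: (nth c0 s k j); case: beta.
rewrite step_indep // big_allpairs_dep /=.
rewrite (big_nth c0) /index_iota subn0 -prodEFin; apply: eq_bigr => k _.
rewrite /letter_wt -prodEFin big_enum /=; apply: eq_bigr => j _.
by rewrite step_eq_law /v /step_prob /=; case: (nth c0 s k j); case: beta => //=; rewrite subKr.
Qed.

Lemma height_step_letter j n w :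
  height r j (prefix d T (letter r) step_letter n w) =
  if beta then (\sum_(k < n) step j k w)%N else (\sum_(k < n) ~~ step j k w)%N.
Proof.
have -> : height r j (prefix d T (letter r) step_letter n w) =
    (\sum_(k < n) (step j k w == beta))%N.
  elim: n => [|n IH]; first by rewrite big_ord0.
  by rewrite /prefix mkseqS height_rcons big_ord_recr IH ffunE.
by case: beta; apply: eq_bigr => k _; case: (step j k w).
Qed.

(** Both kinds of step having occurred before [n], both coordinates are positive and [bvisibleP]
    applies; their sum is [n], so [dvdn_pair_min_max] yields [prime_hit]. *)
Lemma unhit_bvisible (b1 b2 n : nat) w : beta = (b2 <= b1)%N ->
  (0 < b1)%N -> (0 < b2)%N -> coprime b1 b2 ->
  (forall j b, exists2 k, (k < n)%N & step j k w = b) ->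
  (forall j : 'I_r, bvisible b1 b2 (walk (fun k => step j k w) n)) <->
  unhit r (minn b1 b2) (maxn b1 b2) (prefix d T (letter r) step_letter n w).
Proof.
move=> betaE b10 b20 cb both.
have m0 : (0 < minn b1 b2)%N by rewrite leq_min b10 b20.
set pre := prefix d T (letter r) step_letter n w.
have sz : size pre = n by rewrite size_mkseq.
have n0 (j : 'I_r) : (0 < n)%N by case: (both j true) => k /(leq_ltn_trans (leq0n k)).
have pos j b : (0 < \sum_(k < n) (step j k w == b))%N.
  have [k kn kb] := both j b.
  by rewrite (bigD1 (Ordinal kn)) //= kb eqxx.
have key j : bvisible b1 b2 (walk (fun k => step j k w) n) <->
    (forall p, prime p -> ~~ prime_hit (minn b1 b2) (maxn b1 b2) (size pre) (height r j pre) p).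
  have eT : (\sum_(k < n) (step j k w == true) = \sum_(k < n) step j k w)%N.
    by apply: eq_bigr => k _; case: (step j k w).
  have eF : (\sum_(k < n) (step j k w == false) = \sum_(k < n) ~~ step j k w)%N.
    by apply: eq_bigr => k _; case: (step j k w).
  have x0 := pos j true; have y0 := pos j false; rewrite eT in x0; rewrite eF in y0.
  have xy : (\sum_(k < n) step j k w + \sum_(k < n) ~~ step j k w = n)%N.
    rewrite -big_split /= -[RHS](card_ord n) -sum1_card; apply: eq_bigr => k _.
    by case: (step j k w).
  rewrite /walk bvisibleP //.
  by split=> H p /H; rewrite dvdn_pair_min_max xy /prime_hit sz height_step_letter betaE.
(* Positivity of [n] is obtained from some walk; for [r = 0] both sides are vacuously true. *)
case: (posnP r) => [r0|r0].
  split=> [_|_ j]; last by have := ltn_ord j; rewrite {2}r0.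
  by apply/forallP => j; have := ltn_ord j; rewrite {2}r0.
have s0 : (0 < size pre)%N by rewrite sz (n0 (Ordinal r0)).
split=> [H|/(unhitP _ _ _ m0 _ s0) H j]; last by apply/key; apply: H.
by apply/(unhitP _ _ _ m0 _ s0) => j; apply/key.
Qed.

End IndependentSteps.

(** * The almost sure limit of the averages *)

Theorem theorem1p2 (R : realType) (d : measure_display) (T : measurableType d)
  (P : probability T R) (b1 b2 r : nat) (alpha : 'I_r -> R)
  (step : 'I_r -> nat -> T -> bool) :
  (0 < b1)%N -> (0 < b2)%N -> coprime b1 b2 -> (1 <= r)%N ->
  (forall j, 0 < alpha j < 1) ->
  (forall j i, measurable [set w | step j i w]) ->
  (forall j i, P [set w | step j i w] = (alpha j)%:E) ->
  mutually_independent P (fun k : 'I_r * nat => step k.1 k.2) ->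
  exists L : R,
    (euler_partial R b1 b2 r @ \oo --> L) /\
    {ae P, forall w, (fun n => Rbar R b1 b2 step n w) @ \oo --> L}.
Proof.
move=> b10 b20 cb r1 alpha01 sm sl si.
have [L cL] := euler_partial_cvg R b1 b2 r; exists L; split=> //.
pose beta := (b2 <= b1)%N; pose a := step_prob R r alpha beta.
have a01 j : 0 < a j < 1.
  by rewrite /a /step_prob; have := alpha01 j; case: (beta) => // /andP[? ?]; lra.
pose e := minn b1 b2; pose e' := maxn b1 b2.
have e0 : (0 < e)%N by rewrite leq_min b10 b20.
have e'0 : (0 < e')%N by rewrite leq_max b10.
(* A bound valid for all walks at once. *)
pose kappa := \sum_j (a j * (1 - a j))^-1.
have k0 j : 0 <= (a j * (1 - a j))^-1.
  by have /andP[? ?] := a01 j; rewrite invr_ge0 mulr_ge0 //; lra.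
have kappa0 : 0 <= kappa by apply: sumr_ge0.
have kappa_ge j : (a j * (1 - a j))^-1 <= kappa.
  by rewrite /kappa (bigD1 j) //= lerDl sumr_ge0.
pose pre := prefix d T (letter r) (step_letter d T r step beta).
pose wt := letter_wt R r a.
have wt0 := letter_wt_ge0 R r a a01; have wt1 := letter_wt_sum1 R r a.
pose Y (s : seq (letter r)) : R := (unhit r e e' s)%:R.
have Y01 s : 0 <= Y s <= 1 by rewrite /Y; case: (unhit _ _ _ _); rewrite ?lexx ?ler01.
pose X k (s : seq (letter r)) :=
  \sum_(k ^ 4 <= i < (k ^ 6).+1) recentred R (letter r) wt (k ^ 4) Y i s.
pose Z k w := ((k.+1 ^ 6)%:R^-1 * X k.+1 (pre (k.+1 ^ 6)%N w)) ^+ 2.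
have aeZ : {ae P, forall w, Z^~ w @ \oo --> 0}.
  (* With [K = k.+1], the normalized second moment is at most [(K ^ 6 + 1) * 2 * K ^ 4 / K ^ 12 <= 4
     / K ^ 2], and the sum of [1 / K ^ 2] is at most [2]. *)
  apply: (ae_cvg0_summable R d T P Z (fun k => 4 / k.+1%:R ^+ 2) 8).
  - move=> k; apply: (measurable_prefix_fun R d T (letter r) _
      (measurable_step_letter d T r step sm beta) _
      (fun s => ((k.+1 ^ 6)%:R^-1 * X k.+1 s) ^+ 2)).
  - by move=> k w; apply: sqr_ge0.
  - move=> k; rewrite (integral_prefix R d T P (letter r) wt _
      (measurable_step_letter d T r step sm beta)
      (step_letter_prefix_law R d T P r alpha step sm sl si beta) _
      (fun s => ((k.+1 ^ 6)%:R^-1 * X k.+1 s) ^+ 2)); last by move=> s; apply: sqr_ge0.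
    set K := k.+1; rewrite lee_fin.
    have -> : cexp R (letter r) wt (K ^ 6) (fun s => ((K ^ 6)%:R^-1 * X K s) ^+ 2) [::] =
        (K ^ 6)%:R^-1 ^+ 2 * cexp R (letter r) wt (K ^ 6) (fun s => X K s ^+ 2) [::].
      (* A constant factor is a function of the empty prefix. *)
      rewrite -(cexp_known R _ wt _ 0 (fun=> (K ^ 6)%:R^-1 ^+ 2) (fun s => X K s ^+ 2)) //.
      by apply: eq_cexp => // s _; rewrite exprMn.
    have := recentred_second_moment R (letter r) wt wt0 wt1 (K ^ 4) Y Y01 (K ^ 6).
    have K0 : 0 < K%:R :> R by rewrite ltr0n.
    have K1 : 1 <= K%:R :> R by rewrite ler1n.
    have c0 : 0 <= (K ^ 6)%:R^-1 ^+ 2 :> R by apply: sqr_ge0.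
    move=> /(ler_wpM2l c0) le1; apply: (le_trans le1).
    rewrite natrM -natr1 natrM !natrX.
    apply: (@le_trans _ _ ((K%:R ^+ 6)^-1 ^+ 2 * ((K%:R ^+ 6 + K%:R ^+ 6) * (2 * K%:R ^+ 4)))).
      apply: ler_wpM2l; first exact: sqr_ge0.
      apply: ler_wpM2r; first by rewrite mulr_ge0 // exprn_ge0.
      by rewrite lerD2l exprn_ege1.
    by rewrite le_eqVlt; apply/orP; left; apply/eqP; field; rewrite gt_eqF.
  - move=> n; rewrite -mulr_sumr.
    have : \sum_(0 <= k < n) (k.+1%:R ^+ 2)^-1 <= 2 :> R.
      case: n => [|n]; first by rewrite big_geq.
      rewrite big_nat_recl // expr1n invr1.
      have := sum_inv_sqr_le R 1 n.+2 isT; rewrite big_add1 /= big_add1 /= invr1.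
      by move=> le1; rewrite (_ : 2 = 1 + 1 :> R) // lerD2l.
    by lra.
have aeS : {ae P, forall w, forall j b, exists i, step j i w = b}.
  apply: filter_forall => j.
  apply: (@filter_forall T bool (fun b w => exists i, step j i w = b)) => b.
  exact: (ae_step_eq R d T P r alpha step sm sl si j b).
move: aeZ aeS; apply: filterS2 => w cZ both.
(* [K] picks, for each walk and each kind of step, a time at which it occurs; after the maximum of
   these finitely many times all coordinates are positive. *)
have [K HK] := choice (fun jb : 'I_r * bool => both jb.1 jb.2).
apply: (average_cvg_eventually R (fun i => Y (pre i w)) _ (\max_jb K jb).+1) => //.
- by move=> i; case: asboolP => _; rewrite ?lexx ?ler01.
- move=> i Ki; rewrite /Y; congr (nat_of_bool _)%:R.
  have seen j b : exists2 k, (k < i)%N & step j k w = b.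
    exists (K (j, b)); last exact: (HK (j, b)).
    by apply: leq_trans Ki; rewrite ltnS leq_bigmax.
  have [H1 H2] := unhit_bvisible d T r step beta b1 b2 i w erefl b10 b20 cb seen.
  by apply/idP/asboolP => [/H2|/H1].
apply: average_cvg_pow6 => //; apply/cvgrPdist_le => eps eps0.
have eps4 : 0 < eps / 4 by rewrite divr_gt0.
have [N1 _ hN1] := (cvgrPdist_le _ _).1 cL (eps / 4) eps4.
(* [N] is fixed before [k], as [CN] depends on it. The four quarters of [eps] pay for the Euler
   product tail, the large primes, the recentred sum and [CN / k]. *)
pose N := maxn N1 (Num.truncn (r%:R / (eps / 4))).+1.
have N0 : (0 < N)%N by rewrite leq_max orbT.
have rN : r%:R / N%:R <= eps / 4.
  rewrite ler_pdivrMr ?ltr0n // -ler_pdivrMl // mulrC; apply/ltW.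
  by apply: lt_le_trans (truncnS_gt _) _; rewrite ler_nat leq_maxr.
have EN : `|L - euler_partial R b1 b2 r N.+1| <= eps / 4.
  by apply: hN1 => /=; rewrite leqW // leq_maxl.
pose CN : R := 1 + (primorial e N.+1)%:R + r%:R * (primorial e' N.+1)%:R * kappa
   + 6 * r%:R * kappa.
have eps4sq : 0 < (eps / 4) ^+ 2 by rewrite exprn_gt0.
(* [Z] is a square, hence the threshold [(eps / 4) ^+ 2]. *)
have [K2 _ hK2] := (cvgrPdist_le _ _).1 cZ ((eps / 4) ^+ 2) eps4sq.
exists (maxn K2 (Num.truncn (CN / (eps / 4)))).+1 => // k /= Kk.
case: k Kk => // k; rewrite ltnS => Kk.
have kp : 0 < k.+1%:R :> R by rewrite ltr0n.
have Ck : CN / k.+1%:R <= eps / 4.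
  rewrite ler_pdivrMr // -ler_pdivrMl // mulrC; apply/ltW.
  apply: lt_le_trans (truncnS_gt _) _; rewrite ler_nat ltnS.
  by apply: leq_trans Kk; rewrite leq_maxr.
have n0 : 0 < (k.+1 ^ 6)%:R :> R by rewrite ltr0n expn_gt0.
have Zk : (k.+1 ^ 6)%:R^-1 * `|X k.+1 (pre (k.+1 ^ 6)%N w)| <= eps / 4.
  have := hK2 k (leq_trans (leq_maxl _ _) Kk); rewrite sub0r normrN /Z.
  rewrite ger0_norm ?sqr_ge0 // -real_normK ?num_real // ler_pXn2r // ?nnegrE ?(ltW eps4) //.
  by rewrite normrM ger0_norm ?invr_ge0.
have := unhit_average_bound R r a a01 e e' e0 e'0 kappa kappa_ge kappa0 N k.+1
  (pre (k.+1 ^ 6)%N w) N0 isT (size_mkseq _ _).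
rewrite -/wt -/CN -/Y -/(X k.+1 _) -/(euler_partial R b1 b2 r N.+1).
have -> : \sum_(1 <= i < (k.+1 ^ 6).+1) (unhit r e e' (take i (pre (k.+1 ^ 6)%N w)))%:R =
    \sum_(1 <= i < (k.+1 ^ 6).+1) Y (pre i w) :> R.
  by apply: eq_big_nat => i /andP[_ iN]; rewrite /pre take_prefix.
set S := \sum_(1 <= i < _) _; set E := euler_partial _ _ _ _ _ in EN *.
set n := (k.+1 ^ 6)%:R in n0 Zk *; move=> le1.
have le2 : `|n^-1 * S - E| <= n^-1 * `|X k.+1 (pre (k.+1 ^ 6)%N w)|
    + (r%:R / N%:R + CN / k.+1%:R).
  have -> : n^-1 * S - E = n^-1 * (S - n * E) by rewrite mulrBr mulKf // gt_eqF.
  rewrite normrM (@ger0_norm _ n^-1) ?invr_ge0 ?(ltW n0) // ler_pdivrMl // mulrDr mulrA.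
  by rewrite mulfV ?gt_eqF // mul1r.
have -> : L - n^-1 * S = (L - E) - (n^-1 * S - E) by ring.
apply: (le_trans (ler_normB _ _)); apply: (le_trans (lerD EN le2)).
apply: (le_trans (lerD (lexx _) (lerD Zk (lerD rN Ck)))); lra.
Qed.
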